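(* Fix an integer $\delta\ge1$. There is a constant $K_\delta$ such that for every $L$ the following holds on the $L\times L$ nearest-neighbour qubit lattice ($N=L^2$). Let $P$ be the set of unordered pairs $\{x,y\}$ of distinct sites with $\|x-y\|_\infty\le\delta$, and for each $\{x,y\}\in P$ let $H_{xy}$ be any Hermitian, fermion-parity-even operator in the algebra generated by $c_x,c_y,c_x^\dagger,c_y^\dagger$ (e.g. a hopping term $c_x^\dagger c_y+c_y^\dagger c_x$ or a density–density term $n_xn_y$) and $\theta_{xy}\in\mathbb R$. Then there exist canonical orderings $m_0,m_1$, an enumeration $p_1,\dots,p_{|P|}$ of $P$, and a qubit circuit $V$ consisting of at most $K_\delta N$ single-qubit gates and CNOT gates between nearest neighbours, of depth at most $K_\delta L$, such that $$V\,\Phi_{m_0}=\Phi_{m_1}\,e^{-i\theta_{p_{|P|}}H_{p_{|P|}}}\cdots e^{-i\theta_{p_1}H_{p_1}}.$$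
   Context: Qubits sit on the grid $\{0,\dots,L-1\}^2$; two-qubit gates are allowed only between sites at $\ell_1$-distance 1. There is one fermionic mode per site, with ladder operators $c_x,c_x^\dagger$ and $n_x=c_x^\dagger c_x$; fermion-parity-even means commuting with $(-1)^{n_x+n_y}$. A canonical ordering is a bijection $m$ from sites to $\{0,\dots,N-1\}$. The JW isometry $\Phi_m$ from the fermionic Fock space to the $N$-qubit space is the unique unitary with $\Phi_m|\mathrm{vac}\rangle=|0\cdots0\rangle$ and $\Phi_m c_x\Phi_m^\dagger=\tfrac12(X_x+iY_x)\prod_{y:\,m(y)<m(x)}Z_y$ for all sites $x$ (so mode $x$ is stored on qubit $x$). *)

(* Defs.v *)
From HB Require Import structures.
From mathcomp Require Import all_boot all_order all_algebra.
From mathcomp Require Import complex.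
From mathcomp Require Import all_classical all_reals all_analysis.
Set Implicit Arguments.
Unset Strict Implicit.
Unset Printing Implicit Defensive.
Import Order.TTheory GRing.Theory Num.Theory numFieldNormedType.Exports.
Local Open Scope ring_scope.

Fixpoint allProp {T : Type} (P : T -> Prop) (s : seq T) : Prop :=
  match s with [::] => True | x :: s' => P x /\ allProp P s' end.

Section Defs.
Variable R : realType.
Local Notation C := R[i].
Variable L : nat.

Definition site := ('I_L * 'I_L)%type.

Definition distn' (a b : nat) : nat := ((a - b) + (b - a))%N.
Definition dinf (x y : site) : nat := maxn (distn' x.1 y.1) (distn' x.2 y.2).
Definition dist1 (x y : site) : nat := (distn' x.1 y.1 + distn' x.2 y.2)%N.

(* Basis labels.  A basis vector is labelled by a subset S of sites:
   - in the fermionic Fock space, S is the set of occupied modes;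
   - in the N-qubit space, S is the set of qubits in state |1>.
   Both spaces have dimension 2^N = #|{set site}|, and operators on them
   (and the maps Phi between them) are #|{set site}|-square matrices. *)
Definition cfg := {set site}.
Definition fdim := #|{: cfg}|.
Definition Op := 'M[C]_fdim.

Definition mkop (f : cfg -> cfg -> C) : Op :=
  \matrix_(i, j) f (enum_val i) (enum_val j).

Definition adj n (A : 'M[C]_n) : 'M[C]_n := (map_mx (@conjc R) A)^T.
Definition unitary n (U : 'M[C]_n) := U *m adj U = 1%:M /\ adj U *m U = 1%:M.

Definition mprod (s : seq Op) : Op := foldr mulmx 1%:M s.

(* The basis vector labelled S is c^dag_{s_1} ... c^dag_{s_k} |vac>, with
   s_1 < ... < s_k in a fixed reference order of the sites (enum_rank). *)
Definition fsign (S : cfg) (x : site) : C :=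
  (-1) ^+ #|[set y in S | (enum_rank y < enum_rank x)%N]|.
Definition cann (x : site) : Op :=
  mkop (fun T S => if (x \in S) && (T == S :\ x) then fsign S x else 0).
Definition ccre (x : site) : Op := adj (cann x).
Definition nop (x : site) : Op := ccre x *m cann x.
Definition vac : 'cV[C]_fdim := \col_i (if (#|(enum_val i : cfg)| == 0)%N then 1 else 0).

(* (-1)^(n_x + n_y) = (1 - 2 n_x)(1 - 2 n_y)  (n_x, n_y commuting projectors) *)
Definition parity (x y : site) : Op :=
  (1%:M - 2%:R *: nop x) *m (1%:M - 2%:R *: nop y).
Definition parity_even (x y : site) (H : Op) := H *m parity x y = parity x y *m H.

Definition in_gen_alg (gens : seq Op) (H : Op) :=
  exists s : seq (C * seq Op),
    (forall w, w \in s -> forall g, g \in w.2 -> g \in gens) /\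
    H = \sum_(w <- s) w.1 *: mprod w.2.

Definition is_hermitian (H : Op) := adj H = H.

Definition mpow (A : Op) (k : nat) : Op := iter k (mulmx A) 1%:M.
Definition psum (A : Op) (n : nat) : Op := \sum_(k < n) (k`!%:R)^-1 *: mpow A k.
Definition mexp (A : Op) : Op :=
  \matrix_(i, j) Complex (limn (fun n => complex.Re (psum A n i j)))
                         (limn (fun n => complex.Im (psum A n i j))).

Definition flipq (x : site) (S : cfg) : cfg := if x \in S then S :\ x else x |: S.
Definition Xq (x : site) : Op := mkop (fun T S => if T == flipq x S then 1 else 0).
Definition Yq (x : site) : Op :=
  mkop (fun T S => if T == flipq x S then (if x \in S then Complex 0 (-1) else Complex 0 1)
                   else 0).
Definition Zq (x : site) : Op := mkop (fun T S => if T == S then (if x \in S then -1 else 1) else 0).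
Definition qzero : 'cV[C]_fdim := \col_i (if (#|(enum_val i : cfg)| == 0)%N then 1 else 0).

Definition ordering := site -> 'I_(L * L).

Definition jw (m : ordering) (x : site) : Op :=
  ((2%:R)^-1 *: (Xq x + Complex 0 1 *: Yq x)) *m
    \big[mulmx/1%:M]_(y | (m y < m x)%N) Zq y.

Definition isJW (m : ordering) (Phi : Op) :=
  unitary Phi /\ Phi *m vac = qzero /\
  forall x, Phi *m cann x *m adj Phi = jw m x.

Inductive gate :=
| G1 of site & 'M[C]_2
| CNOT of site & site.

Definition gate_ok (g : gate) :=
  match g with
  | G1 _ U => unitary U
  | CNOT c t => dist1 c t = 1%N
  end.

Definition gate_support (g : gate) : seq site :=
  match g with G1 x _ => [:: x] | CNOT c t => [:: c; t] end.

Definition bit (b : bool) : 'I_2 := if b then ord_max else ord0.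

Definition gate_op (g : gate) : Op :=
  match g with
  | G1 x U => mkop (fun T S => if T :\ x == S :\ x then U (bit (x \in T)) (bit (x \in S)) else 0)
  | CNOT c t => mkop (fun T S => if T == (if c \in S then flipq t S else S) then 1 else 0)
  end.

Definition layer := seq gate.
Definition layer_ok (l : layer) :=
  allProp gate_ok l /\ uniq (flatten (map gate_support l)).
Definition layer_op (l : layer) : Op := mprod (map gate_op l).

(* a circuit: list of layers, the first layer being applied first *)
Definition circuit := seq layer.
Definition circuit_ok (c : circuit) := allProp layer_ok c.
Definition circ_op (c : circuit) : Op := foldr (fun l acc => acc *m layer_op l) 1%:M c.
Definition depth (c : circuit) : nat := size c.
Definition gate_count (c : circuit) : nat := sumn (map size c).

Definition Pset (delta : nat) : {set {set site}} :=
  [set e | [exists x, exists y, [&& x != y, (dinf x y <= delta)%N & e == [set x; y]]]].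

Definition evol (H : {set site} -> Op) (theta : {set site} -> R) (ps : seq {set site}) : Op :=
  foldr (fun e acc => acc *m mexp (Complex 0 (- theta e) *: H e)) 1%:M ps.

End Defs.

(* Main.v *)
Require Import Defs.
From HB Require Import structures.
From mathcomp Require Import all_boot all_order all_algebra.
From mathcomp Require Import complex.
From mathcomp Require Import all_classical all_reals all_analysis.
From mathcomp Require Import spectral zify ring.
Import Order.TTheory GRing.Theory Num.Theory.
Local Open Scope ring_scope.
Set Implicit Arguments.
Unset Strict Implicit.
Unset Printing Implicit Defensive.

(* Order the modes strip by strip, inside a strip column by column.  If the strips
   have height 2 delta, a mode lying between two modes of the same strip within
   distance delta of each other is itself close to both, so such a pair evolves
   under the Jordan-Wigner map by a bounded gate: the CZ gates to the modes in
   between remove the sign string, and what remains is a parity-preserving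
   two-qubit unitary.  The strips of height 2 delta and the same strips shifted
   by delta contain all pairs.  To pass from one family to the other, both orders
   are compared with the order by strips of height delta.  There the inversions
   are the pairs (x in the top half, y in the bottom half, y left of x); the
   corresponding product of CZ is obtained by letting a row of CNOT gates
   accumulate the parity of the bottom half from left to right, applying one CZ
   per top site, and undoing the accumulation.  Inside a strip everything takes
   O(L) gates, so it can be executed sequentially, all strips in parallel. *)

(** * Monomial operators and ladder operators *)

Section Operators.
Variables (R : realType) (L : nat).
Local Notation C := R[i].
Local Notation cfg := (cfg L).
Local Notation Op := (Op R L).
Implicit Types (S T F : cfg) (A B : Op) (x y z w : site L).

(** In any single row-by-row order a vertical term carries a sign string of length about [L], so
    implementing the terms one by one exceeds O(N) gates. The strips shorten the strings, and the
    freedom to choose the enumeration is spent on grouping pairs by family and by strip. Two orders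
    are linked by CZ gates because conjugating a ladder operator of [x] by the CZ on [x], [y]
    toggles [Z_y] in its string: exactly what is required for an inverted pair. A strip has on the
    order of [L^2] inversions, too many to treat singly, hence the accumulated parity. The order by
    half-strips is a meeting point of both families because the shift by [delta] is exactly one
    half-strip. Evenness of the Hamiltonian is used twice: it makes the term commute with the ladder
    operators of all other modes, so that its image differs from a two-site operator only by the
    string; and it makes that image preserve the parity of the two sites, so that one CNOT on each
    side turns it into a one-qubit gate selected by a control. All bounds inside a strip are crude
    constants in [delta] times [L]. *)

Definition ent A T S : C := A (enum_rank T) (enum_rank S).

Lemma entP A B : (forall T S, ent A T S = ent B T S) -> A = B.
Proof.
by move=> h; apply/matrixP=> i j; have := h (enum_val i) (enum_val j); rewrite /ent !enum_valK.
Qed.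

Lemma ent_mkop (f : cfg -> cfg -> C) T S : ent (mkop f) T S = f T S.
Proof. by rewrite /ent /mkop mxE !enum_rankK. Qed.

Lemma ent_mul A B T S : ent (A *m B) T S = \sum_U ent A T U * ent B U S.
Proof.
rewrite /ent mxE (reindex enum_rank); first by [].
by exists enum_val => ? _; rewrite ?enum_valK ?enum_rankK.
Qed.

Lemma ent1 T S : ent 1%:M T S = (T == S)%:R.
Proof. by rewrite /ent mxE (inj_eq enum_rank_inj). Qed.

Lemma ent_adj A T S : ent (adj A) T S = conjc (ent A S T).
Proof. by rewrite /ent /adj !mxE. Qed.

Lemma ent_add A B T S : ent (A + B) T S = ent A T S + ent B T S.
Proof. by rewrite /ent mxE. Qed.

Lemma ent_scale (a : C) A T S : ent (a *: A) T S = a * ent A T S.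
Proof. by rewrite /ent mxE. Qed.

Lemma ent_opp A T S : ent (- A) T S = - ent A T S.
Proof. by rewrite /ent mxE. Qed.

(** Ladder operators, Pauli strings, CZ products and CNOTs all send each basis vector to a multiple
    of one basis vector. In this form operator identities become identities between sets and
    signs. *)
Definition mono (p : cfg -> cfg) (f : cfg -> C) : Op :=
  mkop (fun T S => if T == p S then f S else 0).

Lemma ent_mono p f T S : ent (mono p f) T S = if T == p S then f S else 0.
Proof. exact: ent_mkop. Qed.

Lemma ent_mul_mono A p f T S : ent (A *m mono p f) T S = ent A T (p S) * f S.
Proof.
rewrite ent_mul (bigD1 (p S)) //= ent_mono eqxx big1 ?addr0 // => U /negPf hU.
by rewrite ent_mono hU mulr0.
Qed.

Lemma ent_mono_mul A p f T S : involutive p ->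
  ent (mono p f *m A) T S = f (p T) * ent A (p T) S.
Proof.
move=> pK; rewrite ent_mul (bigD1 (p T)) //= ent_mono pK eqxx big1 ?addr0 // => U hU.
by rewrite ent_mono -{1}(pK T) (inj_eq (inv_inj pK)) eq_sym (negPf hU) mul0r.
Qed.

Lemma eq_mono p q f g : (forall S, p S = q S) -> f =1 g -> mono p f = mono q g.
Proof. by move=> hp hf; apply: entP => T S; rewrite !ent_mono hp hf. Qed.

Lemma mono_mul p q f g :
  mono p f *m mono q g = mono (fun S => p (q S)) (fun S => f (q S) * g S).
Proof.
by apply: entP => T S; rewrite ent_mul_mono !ent_mono; case: eqP => //; rewrite mul0r.
Qed.

Lemma mono1 : mono id (fun=> 1) = 1%:M.
Proof. by apply: entP => T S; rewrite ent_mono ent1; case: eqP. Qed.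

Lemma adj_mono p f : involutive p ->
  adj (mono p f) = mono p (fun S => conjc (f (p S))).
Proof.
move=> pK; apply: entP => T S; rewrite ent_adj !ent_mono.
rewrite -{1}(pK S) (inj_eq (inv_inj pK)) eq_sym.
by case: eqP => [->|]; rewrite ?pK ?rmorph0.
Qed.

Lemma adj_mul A B : adj (A *m B) = adj B *m adj A.
Proof. by rewrite /adj map_mxM trmx_mul. Qed.

Lemma adj_adj A : adj (adj A) = A.
Proof. by apply: entP => T S; rewrite !ent_adj conjcK. Qed.

Lemma adj_id : adj (1%:M : Op) = 1%:M.
Proof. by rewrite /adj map_mx1 trmx1. Qed.

Lemma unitary_mul A B : unitary A -> unitary B -> unitary (A *m B).
Proof.
move=> [a1 a2] [b1 b2]; split; rewrite adj_mul -mulmxA.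
  by rewrite (mulmxA B) b1 mul1mx.
by rewrite (mulmxA (adj A)) a2 mul1mx.
Qed.

Lemma unitary1 : unitary (1%:M : Op).
Proof. by split; rewrite adj_id mulmx1. Qed.

Lemma unitary_adj A : unitary A -> unitary (adj A).
Proof. by case=> a b; split; rewrite adj_adj. Qed.

(** Symmetric difference, written as bitwise addition: configurations form a vector space over F_2,
    and flipping a qubit is a translation. *)
Definition sx S F : cfg := [set z | (z \in S) (+) (z \in F)].

Lemma in_sx z S F : (z \in sx S F) = (z \in S) (+) (z \in F).
Proof. by rewrite inE. Qed.

Lemma sxC S F : sx S F = sx F S.
Proof. by apply/setP=> z; rewrite !in_sx addbC. Qed.

Lemma sxA S T F : sx S (sx T F) = sx (sx S T) F.
Proof. by apply/setP=> z; rewrite !in_sx addbA. Qed.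

Lemma sxx S : sx S S = finset.set0.
Proof. by apply/setP=> z; rewrite in_sx addbb inE. Qed.

Lemma sx0 S : sx S finset.set0 = S.
Proof. by apply/setP=> z; rewrite in_sx inE addbF. Qed.

Lemma sxK F : involutive (sx^~ F).
Proof. by move=> S; rewrite -sxA sxx sx0. Qed.

Lemma sxAC S T F : sx (sx S T) F = sx (sx S F) T.
Proof. by rewrite -!sxA (sxC T). Qed.

Lemma in_sx1 z S x : (z \in sx S [set x]) = (z \in S) (+) (z == x).
Proof. by rewrite in_sx inE. Qed.

Lemma flipqE x S : flipq x S = sx S [set x].
Proof.
apply/setP=> z; rewrite /flipq in_sx1; case: ifPn => hx; rewrite !inE;
by case: eqP => [->|_]; rewrite ?hx ?(negPf hx) ?addbF.
Qed.

(** The eigenvalue on the basis vector [S] of the product of [Z_y] over [P], thus a Jordan-Wigner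
    string. It is a character in [S], and also turns exclusive or of the predicates into a
    product. *)
Definition chi (P : pred (site L)) S : C := \prod_(y | P y) (-1) ^+ (y \in S).

Lemma chi_sx P S F : chi P (sx S F) = chi P S * chi P F.
Proof.
by rewrite /chi -big_split; apply: eq_bigr => y _; rewrite in_sx signr_addb.
Qed.

Lemma chi_set1 P x : chi P [set x] = (-1) ^+ (P x).
Proof.
rewrite /chi; case: (boolP (P x)) => hx.
  rewrite (bigD1 x) //= inE eqxx big1 ?mulr1 ?hx // => y /andP[_ /negPf hy].
  by rewrite inE hy.
by apply: big1 => y hy; rewrite inE; case: (y =P x) hy => [->|//]; rewrite (negPf hx).
Qed.

Lemma chi_sx1 P S x : chi P (sx S [set x]) = chi P S * (-1) ^+ (P x).
Proof. by rewrite chi_sx chi_set1. Qed.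

Lemma chi0 P : chi P finset.set0 = 1.
Proof. by rewrite /chi big1 // => y _; rewrite inE. Qed.

Lemma chi_sqr P S : chi P S * chi P S = 1.
Proof. by rewrite -chi_sx sxx chi0. Qed.

Lemma chi_xor P Q S : chi (fun y => P y (+) Q y) S = chi P S * chi Q S.
Proof.
rewrite /chi !(big_mkcond _ (fun y => _ ^+ _)) -big_split; apply: eq_bigr => y _ /=.
by case: (P y); case: (Q y); rewrite /= ?mulr1 ?mul1r // -signr_addb addbb.
Qed.

Lemma eq_chi P Q S : P =1 Q -> chi P S = chi Q S.
Proof. by move=> h; apply: eq_bigl. Qed.

Lemma conjcM (a b : C) : conjc (a * b) = conjc a * conjc b.
Proof. exact: rmorphM. Qed.

Lemma conjc_sign (b : bool) : conjc ((-1) ^+ b : C) = (-1) ^+ b.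
Proof. exact: rmorph_sign. Qed.

Lemma conjc_chi P S : conjc (chi P S) = chi P S.
Proof. by rewrite /chi rmorph_prod; apply: eq_bigr => y _; exact: conjc_sign. Qed.

(* [b = false] annihilates, [b = true] creates; [r] is the mode ordering. *)
Definition ladder (r : site L -> nat) (b : bool) (x : site L) : Op :=
  mono (sx^~ [set x]) (fun S => ((x \in S) (+) b)%:R * chi (fun y => (r y < r x)%N) S).

Lemma adj_ladder r b x : adj (ladder r b x) = ladder r (~~ b) x.
Proof.
rewrite adj_mono; last exact: sxK.
apply: eq_mono => // S; rewrite conjcM conjc_chi chi_sx1 ltnn mulr1 conjc_nat.
by rewrite in_sx1 eqxx addbT; case: (x \in S); case: b.
Qed.

Lemma fsignE S x : fsign R S x = chi (fun y => (enum_rank y < enum_rank x)%N) S.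
Proof.
rewrite /fsign /chi -sum1_card (eq_bigl (fun y => (enum_rank y < enum_rank x)%N && (y \in S))); last first.
  by move=> y; rewrite inE andbC.
rewrite big_mkcondr /= expr_sum; apply: eq_bigr => y _.
by case: ifP.
Qed.

Lemma cannE x : cann R x = ladder (fun y => enum_rank y) false x.
Proof.
apply: entP => T S; rewrite ent_mkop ent_mono addbF fsignE.
have -> : ((x \in S) && (T == S :\ x)) = ((x \in S) && (T == sx S [set x])).
  case hx: (x \in S) => //=; congr (T == _); have := flipqE x S.
  by rewrite /flipq hx.
by case: (x \in S); rewrite /= ?mul1r ?mul0r // if_same.
Qed.

Lemma ccreE x : ccre R x = ladder (fun y => enum_rank y) true x.
Proof. by rewrite /ccre cannE adj_ladder. Qed.

(** Exactly one of the two modes lies in the string of the other, so swapping the order of the flips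
    costs one sign. *)
Lemma ladder_anticomm r b c x y : injective r -> x != y ->
  ladder r b x *m ladder r c y = - (ladder r c y *m ladder r b x).
Proof.
move=> rI nxy; rewrite !mono_mul; apply: entP => T S.
rewrite ent_opp !ent_mono sxAC; case: ifP => _; last by rewrite oppr0.
rewrite !in_sx1 !chi_sx1 (negPf nxy) eq_sym (negPf nxy) !addbF.
have : r x != r y by rewrite (inj_eq rI).
by case: ltngtP => // _ _; rewrite /=; ring.
Qed.

Lemma ladder_num r x : ladder r true x *m ladder r false x = mono id (fun S => (x \in S)%:R).
Proof.
rewrite mono_mul; apply: eq_mono => S; first by rewrite sxK.
rewrite chi_sx1 ltnn mulr1 in_sx1 eqxx !addbT !addbF negbK.
by case: (x \in S); rewrite /= ?mul0r ?mulr0 // !mul1r chi_sqr.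
Qed.

(** A Majorana operator: the occupation factors add up to 1, which leaves an invertible flip with
    its string. *)
Lemma ladder_sum r x : ladder r false x + ladder r true x =
  mono (sx^~ [set x]) (chi (fun y => (r y < r x)%N)).
Proof.
apply: entP => T S; rewrite ent_add !ent_mono; case: ifP => _; last by rewrite addr0.
by rewrite addbF addbT; case: (x \in S); rewrite /= ?mul0r ?mul1r ?add0r ?addr0.
Qed.

Lemma ZqE x : Zq R x = mono id (fun S => (-1) ^+ (x \in S)).
Proof. by apply: entP => T S; rewrite ent_mkop ent_mono; case: (x \in S). Qed.

(** Fock operators and their qubit images thereby belong to one family [ladder], and differ only in
    the order that defines the string. *)
Lemma jwE (m : ordering L) x : jw R m x = ladder (fun y => m y) false x.
Proof.
have gen (s : seq (site L)) : \big[mulmx/1%:M]_(y <- s | (m y < m x)%N) Zq R y =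
    mono id (fun S => \prod_(y <- s | (m y < m x)%N) (-1) ^+ (y \in S)).
  elim: s => [|z s IH].
    by rewrite big_nil -mono1; apply: eq_mono => // S; rewrite big_nil.
  rewrite big_cons IH; case: ifP => hz; last first.
    by apply: eq_mono => // S; rewrite big_cons hz.
  by rewrite ZqE mono_mul; apply: eq_mono => // S; rewrite big_cons hz.
rewrite /jw gen.
apply: entP => T S; rewrite ent_mono ent_mul_mono ent_scale ent_add ent_scale !ent_mkop.
rewrite flipqE addbF; case: eqP => _; last by rewrite mulr0 addr0 mulr0 mul0r.
case: (x \in S); congr (_ * _).
  have -> : 'i%C * Complex 0 (-1) = 1 :> C.
    by apply/eqP; rewrite eq_complex /= !mulr0 !mul0r mul1r opprK add0r addr0 !eqxx.
  by rewrite -[1 + 1]/(2%:R) mulVf ?pnatr_eq0.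
by rewrite -expr2 sqr_i subrr mulr0.
Qed.

End Operators.

(** * Change of ordering and uniqueness of the Jordan-Wigner isometry *)

Section JordanWigner.
Variables (R : realType) (L : nat).
Local Notation C := R[i].
Local Notation cfg := (cfg L).
Local Notation Op := (Op R L).
Local Notation mono := (@mono R L).
Implicit Types (S T F : cfg) (A B : Op) (x y z w : site L) (E : rel (site L)) (m : ordering L).

(** [E] lists ordered pairs, and a pair listed in both directions cancels. This is why later
    conditions involve the exclusive or of [E x y] and [E y x]. *)
Definition cz E S : C := \prod_x \prod_(y | E x y) (-1) ^+ ((x \in S) && (y \in S)).

Definition czop E : Op := mono id (cz E).

(** [cz E] is the sign of a quadratic form over F_2. Flipping one bit changes such a form by a
    linear one, supported on the neighbours of that bit. *)
Lemma cz_sx1 E S z : E z z = false ->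
  cz E (sx S [set z]) = cz E S * chi R (fun y => E z y (+) E y z) S.
Proof.
move=> hz; rewrite chi_xor mulrA.
have -> : chi R (E z) S =
    \prod_x \prod_(y | E x y) (-1) ^+ ((x == z) && (y \in S)).
  rewrite (bigD1 z) //= [X in _ * X]big1 ?mulr1; last first.
    by move=> x /negPf hx; rewrite big1 // => y _; rewrite hx.
  by apply: eq_bigr => y _; rewrite eqxx.
have -> : chi R (E^~ z) S =
    \prod_x \prod_(y | E x y) (-1) ^+ ((x \in S) && (y == z)).
  rewrite /chi big_mkcond; apply: eq_bigr => x _ /=; case: ifPn => hx.
    rewrite (bigD1 z) //= eqxx andbT big1 ?mulr1 // => y /andP[_ /negPf hy].
    by rewrite hy andbF.
  rewrite big1 // => y hy; case: (y =P z) hy hx => [->|_ _ _]; last by rewrite andbF.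
  by move=> ->.
rewrite /cz -!big_split; apply: eq_bigr => x _ /=.
rewrite -!big_split; apply: eq_bigr => y hy /=; rewrite !in_sx1 -!signr_addb.
case: (x =P z) (y =P z) hy => [->|_] [->|_]; rewrite ?hz // => _;
by case: (_ \in S); case: (_ \in S).
Qed.

Lemma cz0 E : cz E finset.set0 = 1.
Proof. by rewrite /cz big1 // => x _; rewrite big1 // => y _; rewrite inE. Qed.

Lemma cz_sqr E S : cz E S * cz E S = 1.
Proof.
rewrite /cz -big_split big1 // => x _ /=; rewrite -big_split big1 // => y _ /=.
by rewrite -signr_addb addbb.
Qed.

Lemma conjc_cz E S : conjc (cz E S) = cz E S.
Proof.
rewrite /cz rmorph_prod; apply: eq_bigr => x _; rewrite rmorph_prod.
by apply: eq_bigr => y _; exact: conjc_sign.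
Qed.

Lemma adj_czop E : adj (czop E) = czop E.
Proof. by rewrite adj_mono //; apply: eq_mono => // S; rewrite conjc_cz. Qed.

Lemma czopK E : czop E *m czop E = 1%:M.
Proof. by rewrite mono_mul -mono1; apply: eq_mono => // S; rewrite cz_sqr. Qed.

Lemma unitary_czop E : unitary (czop E).
Proof. by split; rewrite adj_czop czopK. Qed.

Lemma eq_czop E E' : (forall x y, E x y = E' x y) -> czop E = czop E'.
Proof.
move=> h; apply: eq_mono => // S; apply: eq_bigr => x _; exact: eq_bigl.
Qed.

(** The sign change of [cz E] under the flip of [x] is a string over the neighbours of [x]. When [E]
    joins exactly the pairs on which [r] and [r'] disagree, it corrects one string into the
    other. *)
Lemma czop_ladder E (r r' : site L -> nat) b x : (forall z, E z z = false) ->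
  (forall x y, (r' y < r' x)%N = (r y < r x)%N (+) (E x y (+) E y x)) ->
  czop E *m ladder R r b x *m czop E = ladder R r' b x.
Proof.
move=> hE hr; rewrite !mono_mul; apply: eq_mono => // S.
rewrite cz_sx1 // (eq_chi _ _ (hr x)).
rewrite (chi_xor _ (fun y => r y < r x)%N (fun y => E x y (+) E y x)).
by have := cz_sqr E S; set a := cz E S; move=> ha; ring: ha.
Qed.

Definition basis S : 'cV[C]_(fdim L) := \col_i (enum_val i == S)%:R.

Lemma vacE : vac R L = basis finset.set0.
Proof.
apply/colP=> i; rewrite !mxE cards_eq0.
by case: eqP.
Qed.

Lemma mul_basis A S i : (A *m basis S) i 0 = A i (enum_rank S).
Proof.
rewrite mxE (bigD1 (enum_rank S)) //= big1 ?addr0 ?mxE ?enum_rankK ?eqxx ?mulr1 //.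
move=> j hj; rewrite mxE; case: eqP => [e|_]; last by rewrite mulr0.
by rewrite -e enum_valK eqxx in hj.
Qed.

Lemma mono_basis p f S : mono p f *m basis S = f S *: basis (p S).
Proof.
apply/colP=> i; rewrite mul_basis // !mxE enum_rankK.
by case: eqP; rewrite ?mulr1 ?mulr0.
Qed.

Lemma isJW_ladder m (Phi : Op) b x : isJW m Phi ->
  Phi *m ladder R (fun y => enum_rank y) b x = ladder R (fun y => m y) b x *m Phi.
Proof.
move=> [[u1 u2] [_ h]].
have h0 : Phi *m ladder R (fun y => enum_rank y) false x *m adj Phi =
    ladder R (fun y => m y) false x by rewrite -cannE h jwE.
have {h0} : Phi *m ladder R (fun y => enum_rank y) b x *m adj Phi =
    ladder R (fun y => m y) b x.
  case: b => //; have := congr1 (@adj R _) h0.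
  by rewrite !adj_mul adj_adj !adj_ladder mulmxA.
by move=> <-; rewrite -!mulmxA u2 mulmx1.
Qed.

(** Up to sign, a nonempty basis vector is a creation operator applied to one with a mode fewer.
    Both isometries intertwine creation operators in the same way and agree on the vacuum, so
    induction on the number of occupied modes applies. This reduces arbitrary isometries to the
    explicit [JWmat]. *)
Lemma isJW_unique m (Phi Phi' : Op) : isJW m Phi -> isJW m Phi' -> Phi = Phi'.
Proof.
move=> J J'.
suff h S : Phi *m basis S = Phi' *m basis S.
  apply/matrixP=> i j; have := congr1 (fun v : 'cV_ _ => v i 0) (h (enum_val j)).
  by rewrite !mul_basis enum_valK.
move: {2}#|S| (leqnn #|S|) => n; elim: n S => [|n IH] S hS.
  move: hS; rewrite leqn0 cards_eq0 => /eqP ->.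
  by rewrite -vacE; case: J => _ [-> _]; case: J' => _ [-> _].
have [->|[x xS]] := set_0Vmem S.
  by rewrite -vacE; case: J => _ [-> _]; case: J' => _ [-> _].
pose S' := sx S [set x].
have xS' : x \in S' = false by rewrite in_sx1 xS eqxx.
have hS' : (#|S'| <= n)%N.
  have -> : S' = S :\ x by rewrite /S' -flipqE /flipq xS.
  by have := cardsD1 x S; rewrite xS; lia.
pose l := ladder R (fun y => enum_rank y) true x.
have [a ha hl] : exists2 a : C, a * a = 1 & l *m basis S' = a *: basis S.
  exists (chi R (fun y => (enum_rank y < enum_rank x)%N) S'); first exact: chi_sqr.
  by rewrite mono_basis xS' mul1r /S' sxK.
have {hl} -> : basis S = a *: (l *m basis S') by rewrite hl scalerA ha scale1r.
by rewrite -!scalemxAr !mulmxA (isJW_ladder _ _ J) (isJW_ladder _ _ J') -!mulmxA IH.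
Qed.

Lemma isJW_czop m m' (Phi : Op) E : (forall z, E z z = false) ->
  (forall x y, (m' y < m' x)%N = (m y < m x)%N (+) (E x y (+) E y x)) ->
  isJW m Phi -> isJW m' (czop E *m Phi).
Proof.
move=> hE hm J; split; first by apply: unitary_mul; [exact: unitary_czop|case: J].
split; first by case: J => _ [h _]; rewrite -mulmxA h -[qzero _ _]/(vac R L) vacE mono_basis cz0 scale1r.
move=> x; rewrite cannE -mulmxA adj_mul adj_czop.
rewrite -!mulmxA (mulmxA Phi) (isJW_ladder _ _ J).
case: J => [[u1 _] _]; rewrite -(mulmxA _ Phi) (mulmxA Phi (adj Phi)) u1 mul1mx mulmxA.
by rewrite (czop_ladder _ _ hE hm) jwE.
Qed.

(** The Fock basis is already a Jordan-Wigner basis for the enumeration order of the sites, so the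
    isometry for [m] is the CZ product over the inversions of [m] against that order. *)
Definition JWmat m : Op :=
  czop (fun x y => (enum_rank x < enum_rank y)%N && (m y < m x)%N).

Lemma JWmatP m : injective m -> isJW m (JWmat m).
Proof.
move=> mI; have hE (z : site L) : (enum_rank z < enum_rank z)%N && (m z < m z)%N = false.
  by rewrite ltnn.
have hm x y : (m y < m x)%N = (enum_rank y < enum_rank x)%N (+)
   (((enum_rank x < enum_rank y)%N && (m y < m x)%N) (+)
    ((enum_rank y < enum_rank x)%N && (m x < m y)%N)).
  have [->|nxy] := eqVneq x y; first by rewrite !ltnn.
  have h1 : (enum_rank x : nat) != enum_rank y by rewrite (inj_eq val_inj) (inj_eq enum_rank_inj).
  have h2 : (m x : nat) != m y by rewrite (inj_eq val_inj) (inj_eq mI).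
  by case: (ltngtP (enum_rank x) (enum_rank y)) h1 => // _ _;
     case: (ltngtP (m x) (m y)) h2.
split; first exact: unitary_czop.
split; first by rewrite vacE mono_basis cz0 scale1r -vacE.
by move=> x; rewrite adj_czop cannE (czop_ladder _ _ hE hm) jwE.
Qed.

End JordanWigner.

(** * Exponentials of Hermitian operators *)

Section Exponential.
Import numFieldNormedType.Exports.
Local Open Scope classical_set_scope.
Variables (R : realType).
Local Notation C := R[i].

Lemma adjE n (A : 'M[C]_n) i j : adj A i j = conjc (A j i).
Proof. by rewrite !mxE. Qed.

Lemma adjM n (A B : 'M[C]_n) : adj (A *m B) = adj B *m adj A.
Proof. by rewrite /adj map_mxM trmx_mul. Qed.

Lemma adjK n (A : 'M[C]_n) : adj (adj A) = A.
Proof. by apply/matrixP=> i j; rewrite !adjE conjcK. Qed.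

(** Stated for normal matrices so as to serve both Hermitian generators and the 2 by 2 unitaries of
    controlled gates. *)
Lemma normal_diagonalization n (A : 'M[C]_n) : A *m adj A = adj A *m A ->
  exists (P : 'M[C]_n) (d : 'rV[C]_n), unitary P /\ A = adj P *m diag_mx d *m P.
Proof.
move=> hA.
have adjE' (B : 'M[C]_n) : map_mx Num.conj (B^T) = adj B.
  by apply/matrixP=> i j; rewrite !mxE.
have hn : A \is normalmx by apply/normalmxP; rewrite !adjE'.
have Pu := spectral_unitarymx A; set P := spectralmx A in Pu *.
have eP : invmx P = adj P by rewrite invmx_unitary // adjE'.
exists P, (spectral_diag A); split; last first.
  by rewrite -eP; exact: (elimT (@orthomx_spectralP _ _ A) hn).
by split; rewrite -eP ?mulmxV ?mulVmx // unitarymx_unit.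
Qed.

Definition cis (a : R) : C := Complex (cos a) (sin a).

Lemma cis_unit a : cis a * conjc (cis a) = 1.
Proof.
apply/eqP; rewrite eq_complex /=; apply/andP; split; apply/eqP; last by ring.
by rewrite mulrN opprK -!expr2 cos2Dsin2.
Qed.

Lemma exp_term (a : R) k : (k`!%:R)^-1 * (Complex 0 a) ^+ k =
  Complex (cos_coeff a k) (sin_coeff a k) :> C.
Proof.
have e4 m : (Complex 0 a : C) ^+ m.*2 = Complex ((-1) ^+ m * a ^+ m.*2) 0.
  elim: m => [|m IH]; first by rewrite !expr0 mulr1.
  rewrite doubleS !exprS IH; apply/eqP; rewrite eq_complex /=.
  by apply/andP; split; apply/eqP; ring.
have ef : (k`!%:R)^-1 = Complex (k`!%:R)^-1 0 :> C.
  by rewrite -[RHS]/((k`!%:R)^-1%:C)%C fmorphV rmorph_nat.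
rewrite ef /cos_coeff /sin_coeff /=.
have [m [b ->]] : exists m (b : bool), k = (b + m.*2)%N.
  by exists k./2, (odd k); rewrite odd_double_half.
rewrite !oddD !odd_double addbF oddb; case: b => /=; last first.
  rewrite add0n doubleK e4; apply/eqP; rewrite eq_complex /=.
  by apply/andP; split; apply/eqP; rewrite -?exprnP; ring.
rewrite add1n /= doubleK exprS e4; apply/eqP; rewrite eq_complex /=.
by apply/andP; split; apply/eqP; rewrite ?exprS; ring.
Qed.

Lemma cvg_exp_psum (a : R) :
  ((fun n => complex.Re (\sum_(k < n) (k`!%:R)^-1 * (Complex 0 a) ^+ k)) @ \oo --> cos a)
  /\ ((fun n => complex.Im (\sum_(k < n) (k`!%:R)^-1 * (Complex 0 a) ^+ k)) @ \oo --> sin a).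
Proof.
have e n : \sum_(k < n) (k`!%:R)^-1 * (Complex 0 a : C) ^+ k =
    Complex (series (cos_coeff a) n) (series (sin_coeff a) n).
  elim: n => [|n IH]; first by rewrite big_ord0 /series /= !big_geq.
  rewrite big_ord_recr /= IH exp_term /series /= !big_nat_recr //=.
split.
  rewrite (_ : (fun _ => _) = series (cos_coeff a)); last by apply/funext => n; rewrite e.
  by rewrite unlock; exact: is_cvg_series_cos_coeff.
rewrite (_ : (fun _ => _) = series (sin_coeff a)); last by apply/funext => n; rewrite e.
by rewrite unlock; exact: is_cvg_series_sin_coeff.
Qed.

Lemma cvg_sumR (I : Type) (s : seq I) (f : I -> nat -> R) (l : I -> R) :
  (forall i, f i n @[n --> \oo] --> l i) ->
  (\sum_(i <- s) f i n) @[n --> \oo] --> \sum_(i <- s) l i.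
Proof.
move=> h; elim: s => [|i s IH].
  rewrite big_nil (_ : (fun _ => _) = fun=> 0); first exact: cvg_cst.
  by apply/funext => n; rewrite big_nil.
rewrite big_cons (_ : (fun n => _) = (fun n => f i n + \sum_(j <- s) f j n)).
  exact: cvgD.
by apply/funext => n; rewrite big_cons.
Qed.

End Exponential.

(** * The series exponential through the spectral decomposition *)

Section OperatorExponential.
Import numFieldNormedType.Exports.
Local Open Scope classical_set_scope.
Variables (R : realType) (L : nat).
Local Notation C := R[i].
Local Notation Op := (Op R L).

Lemma diag_mx_exp (d : 'rV[C]_(fdim L)) k :
  iter k (mulmx (diag_mx d)) 1%:M = diag_mx (\row_i d 0 i ^+ k).
Proof.
elim: k => [|k IH].
  by apply/matrixP=> i j; rewrite !mxE expr0.
by rewrite iterS IH mulmx_diag; congr diag_mx; apply/rowP=> i; rewrite !mxE exprS.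
Qed.

(** [mexp] is a limit taken entry by entry in real and imaginary parts. In an eigenbasis every entry
    of the partial sums is a fixed finite combination of scalar exponential series, whose parts are
    the cosine and sine series. *)
Lemma mexp_hermitian (A : Op) (t : R) : is_hermitian A ->
  exists (P : Op) (a : 'I_(fdim L) -> R), unitary P /\
   (A = adj P *m diag_mx (\row_i (a i)%:C%C) *m P) /\
   mexp (Complex 0 (- t) *: A) = adj P *m diag_mx (\row_i cis (- t * a i)) *m P.
Proof.
move=> hA.
have [P [d [uP eA]]] : exists (P : Op) (d : 'rV[C]_(fdim L)), unitary P /\ A = adj P *m diag_mx d *m P.
  by apply: normal_diagonalization; rewrite hA.
have [u1 u2] := uP.
(* The diagonal matrix is unitarily conjugate to [A], hence self-adjoint, so the eigenvalues are
   real. *)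
have dR i : d 0 i = (complex.Re (d 0 i))%:C%C.
  have : P *m A *m adj P = diag_mx d.
    by rewrite eA -!mulmxA u1 mulmx1 !mulmxA u1 mul1mx.
  move=> e; have e' : adj (diag_mx d) = diag_mx d.
    by rewrite -e !adjM adjK hA mulmxA.
  have := congr1 (fun M : Op => M i i) e'; rewrite adjE !mxE eqxx !mulr1n.
  by case: (d 0 i) => x y /= [/eqP]; rewrite eq_sym -subr_eq0 opprK -mulr2n mulrn_eq0 /= => /eqP ->.
exists P, (fun i => complex.Re (d 0 i)); split=> //; split.
  by rewrite {1}eA; congr (_ *m diag_mx _ *m _); apply/rowP=> i; rewrite mxE -dR.
pose a i := complex.Re (d 0 i).
pose s i n : C := \sum_(k < n) (k`!%:R)^-1 * (Complex 0 (- t * a i)) ^+ k.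
have powE k : mpow (Complex 0 (- t) *: A) k =
    adj P *m diag_mx (\row_i (Complex 0 (- t * a i) : C) ^+ k) *m P.
  rewrite (_ : \row_i (Complex 0 (- t * a i) : C) ^+ k = \row_i (\row_j (Complex 0 (- t * a j) : C)) 0 i ^+ k); last first.
    by apply/rowP=> i; rewrite !mxE.
  rewrite -diag_mx_exp; set D := diag_mx _.
  have -> : Complex 0 (- t) *: A = adj P *m D *m P.
    rewrite eA scalemxAl scalemxAr; congr (_ *m _ *m _).
    apply/matrixP=> i j; rewrite !mxE; case: eqP => _; last by rewrite !mulr0n mulr0.
    rewrite !mulr1n dR -/(a i); apply/eqP; rewrite eq_complex /=.
    by apply/andP; split; apply/eqP; ring.
  elim: k => [|k IH]; first by rewrite /= mulmx1 u2.
  by rewrite /mpow iterS -/(mpow _ _) IH /= -!mulmxA (mulmxA P) u1 mul1mx.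
have psumE n : psum (Complex 0 (- t) *: A) n = adj P *m diag_mx (\row_i s i n) *m P.
  rewrite /psum (eq_bigr (fun k : 'I_n => adj P *m ((k`!%:R)^-1 *: diag_mx (\row_i (Complex 0 (- t * a i) : C) ^+ k)) *m P)); last first.
    by move=> k _; rewrite powE -scalemxAr -scalemxAl.
  rewrite -mulmx_suml -mulmx_sumr; congr (_ *m _ *m _).
  apply/matrixP=> i j; rewrite summxE !mxE; case: eqP => [->|ne]; last first.
    by rewrite mulr0n big1 // => k _; rewrite !mxE; case: eqP => // _; rewrite mulr0n mulr0.
  by rewrite mulr1n; apply: eq_bigr => k _; rewrite !mxE eqxx mulr1n.
have entE (f : 'I_(fdim L) -> C) i j : (adj P *m diag_mx (\row_i f i) *m P) i j =
    \sum_k (adj P i k * P k j) * f k.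
  by rewrite mxE; apply: eq_bigr => k _; rewrite mul_mx_diag !mxE mulrAC.
have ReD (I : Type) (r : seq I) (f : I -> C) : complex.Re (\sum_(k <- r) f k) = \sum_(k <- r) complex.Re (f k).
  by elim/big_rec2: _ => // k y1 y2 _ <-; case: (f k); case: y2.
have ImD (I : Type) (r : seq I) (f : I -> C) : complex.Im (\sum_(k <- r) f k) = \sum_(k <- r) complex.Im (f k).
  by elim/big_rec2: _ => // k y1 y2 _ <-; case: (f k); case: y2.
have ReM (x y : C) : complex.Re (x * y) = complex.Re x * complex.Re y - complex.Im x * complex.Im y by case: x; case: y.
have ImM (x y : C) : complex.Im (x * y) = complex.Re x * complex.Im y + complex.Im x * complex.Re y by case: x; case: y.
apply/matrixP=> i j; rewrite mxE entE; apply/eqP; rewrite eq_complex /= ReD ImD; apply/andP; split; apply/eqP.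
  apply/cvg_lim => //.
  under eq_fun => n do rewrite psumE entE ReD.
  apply: cvg_sumR => k; under eq_fun => n do rewrite ReM; rewrite ReM /=.
  have [h1 h2] := cvg_exp_psum (- t * a k).
  by apply: cvgB; apply: cvgMr.
apply/cvg_lim => //.
under eq_fun => n do rewrite psumE entE ImD.
apply: cvg_sumR => k; under eq_fun => n do rewrite ImM; rewrite ImM /=.
have [h1 h2] := cvg_exp_psum (- t * a k).
by apply: cvgD; apply: cvgMr.
Qed.

Lemma unitary_mexp (A : Op) (t : R) : is_hermitian A ->
  unitary (mexp (Complex 0 (- t) *: A)).
Proof.
move=> /(mexp_hermitian t) [P [a [[u1 u2] [_ ->]]]].
set D := diag_mx _.
have hD : D *m adj D = 1%:M /\ adj D *m D = 1%:M.
  by split; apply/matrixP=> i j; rewrite ?mul_diag_mx ?mul_mx_diag !mxE;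
    (case: eqP => [->|ne]; first by rewrite ?eqxx !mulr1n ?[_^*%C * _]mulrC cis_unit);
    case: eqP => [e|_]; rewrite ?e // in ne *; rewrite mulr0n ?rmorph0 ?mulr0 ?mul0r.
case: hD => d1 d2; split; rewrite !adjM adjK -!mulmxA.
  by rewrite (mulmxA P) u1 mul1mx (mulmxA D) d1 mul1mx u2.
by rewrite (mulmxA P) u1 mul1mx (mulmxA (adj D)) d2 mul1mx u2.
Qed.

Lemma mexp_comm (A M : Op) (t : R) : is_hermitian A -> A *m M = M *m A ->
  mexp (Complex 0 (- t) *: A) *m M = M *m mexp (Complex 0 (- t) *: A).
Proof.
move=> /(mexp_hermitian t) [P [a [[u1 u2] [eA ->]]]] hM.
set D' := diag_mx _; set D := diag_mx _ in eA.
pose N := P *m M *m adj P.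
have eM : M = adj P *m N *m P by rewrite /N -!mulmxA u2 mulmx1 !mulmxA u2 mul1mx.
have hN : D *m N = N *m D.
  have := congr1 (fun X => P *m X *m adj P) hM; rewrite eA /N.
  rewrite -!mulmxA u1 !mulmx1 (mulmxA P (adj P)) u1 mul1mx.
  by [].
(* Commuting with [D] forces [N i j] to vanish unless the eigenvalues [a i] and [a j] coincide; in
   that case the phases in [D'] coincide too. *)
have hN' : D' *m N = N *m D'.
  apply/matrixP=> i j; have := congr1 (fun X : Op => X i j) hN.
  rewrite !mul_diag_mx !mul_mx_diag !mxE mulrC => /eqP.
  rewrite -subr_eq0 -mulrBr mulf_eq0 => /orP[/eqP ->|]; first by rewrite mulr0 mul0r.
  by rewrite subr_eq0 => /eqP [->]; rewrite mulrC.
clearbody N; by rewrite eM -!mulmxA !(mulmxA P (adj P)) u1 !mul1mx (mulmxA D' N) hN' !mulmxA.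
Qed.

End OperatorExponential.

(** * Gates *)

Section Circuits.
Variables (R : realType) (L : nat).
Local Notation C := R[i].
Local Notation cfg := (cfg L).
Local Notation Op := (Op R L).
Local Notation gate := (gate R L).
Local Notation circuit := (circuit R L).
Implicit Types (S T F : cfg) (A B U V : Op) (x y z w c t : site L) (g : seq gate) (Q : pred (site L)).

(* The head of the list acts first, as in [circ_op] and [evol]. *)
Definition tprod (s : seq Op) : Op := foldr (fun A acc => acc *m A) 1%:M s.

Lemma tprod_cat s1 s2 : tprod (s1 ++ s2) = tprod s2 *m tprod s1.
Proof. by elim: s1 => [|A s IH] /=; rewrite ?mulmx1 // IH mulmxA. Qed.

Lemma tprod_rcons s A : tprod (rcons s A) = A *m tprod s.
Proof. by rewrite -cats1 tprod_cat /= mul1mx. Qed.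

Definition gops g : Op := tprod (map (@gate_op R L) g).

Lemma circ_opE (cc : circuit) : circ_op cc = tprod (map (@layer_op R L) cc).
Proof. by rewrite /circ_op /tprod foldr_map. Qed.

Lemma eqD1 T S x : (T :\ x == S :\ x) = (T == S) || (T == sx S [set x]).
Proof.
apply/eqP/orP => [h|[]/eqP ->]; last 2 first.
- by [].
- by apply/setP=> z; rewrite !inE; case: eqP => // _; rewrite addbF.
have hz z : z != x -> (z \in T) = (z \in S).
  by move=> nz; have := congr1 (fun X : cfg => z \in X) h; rewrite /= !inE nz.
case: (boolP ((x \in T) == (x \in S))) => hx.
  by left; apply/eqP/setP=> z; have [->|/hz] := eqVneq z x; first exact/eqP.
right; apply/eqP/setP=> z; rewrite in_sx1; have [->|nz] := eqVneq z x.
  by case: (x \in T) (x \in S) hx => [] [].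
by rewrite hz // addbF.
Qed.

Lemma neq_sx1 S x : (S == sx S [set x]) = false.
Proof.
apply/eqP=> h; have := congr1 (fun X : cfg => x \in X) h.
by rewrite /= in_sx1 eqxx; case: (x \in S).
Qed.

(* Only meaningful when [U] does not look at the bit [x]. *)
Definition gmux x (U : cfg -> 'M[C]_2) : Op :=
  mkop (fun T S => if T :\ x == S :\ x then U S (bit (x \in T)) (bit (x \in S)) else 0).

Lemma ent_gmux x (U : cfg -> 'M[C]_2) T S : ent (gmux x U) T S =
  if T :\ x == S :\ x then U S (bit (x \in T)) (bit (x \in S)) else 0.
Proof. exact: ent_mkop. Qed.

Lemma gate_op_G1 x (U : 'M[C]_2) : gate_op (G1 x U) = gmux x (fun=> U).
Proof. by []. Qed.

Lemma sum_bit (F : 'I_2 -> C) b : \sum_i F i = F (bit b) + F (bit (~~ b)).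
Proof.
rewrite big_ord_recl big_ord1.
have -> : lift ord0 ord0 = bit true by apply: val_inj.
by case: b => //; rewrite addrC.
Qed.

Lemma bit_eq (b b' : bool) : (bit b == bit b') = (b == b').
Proof. by case: b; case: b'. Qed.

Lemma bitP (i : 'I_2) : exists b, i = bit b.
Proof.
case: i => [[|[|//]] h]; first by exists false; apply: val_inj.
by exists true; apply: val_inj.
Qed.

Lemma gmux_mul x (U V : cfg -> 'M[C]_2) :
  (forall S, U (sx S [set x]) = U S) ->
  gmux x U *m gmux x V = gmux x (fun S => U S *m V S).
Proof.
move=> hU; apply: entP => T S; rewrite ent_mul ent_gmux.
rewrite (bigD1 S) // (bigD1 (sx S [set x])) /=; last by rewrite eq_sym neq_sx1.
rewrite big1 ?addr0; last first.
  move=> W /andP[/negPf h1 /negPf h2].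
  by rewrite [X in _ * X]ent_gmux eqD1 h1 h2 mulr0.
rewrite !ent_gmux hU.
have -> : sx S [set x] :\ x = S :\ x by apply/eqP; rewrite eqD1 eqxx orbT.
rewrite eqxx; case: ifP => _; last by rewrite !mul0r addr0.
by rewrite mxE (sum_bit _ (x \in S)) in_sx1 eqxx addbT.
Qed.

Lemma gmux1 x : gmux x (fun=> 1%:M) = 1%:M.
Proof.
apply: entP => T S; rewrite ent_gmux ent1 eqD1 mxE bit_eq.
case: (T =P S) => [->|ne] /=; first by rewrite eqxx.
by case: eqP => // ->; rewrite in_sx1 eqxx; case: (x \in S).
Qed.

(** Used to transfer unitarity from a multiplexed gate to each of its blocks. *)
Lemma gmux1_inj x (U : cfg -> 'M[C]_2) : (forall S, U (sx S [set x]) = U S) ->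
  gmux x U = 1%:M -> forall S, U S = 1%:M.
Proof.
move=> hU h S; apply/matrixP=> i j; have [b ->] := bitP i; have [b' ->] := bitP j.
pose set_x a : cfg := if a == (x \in S) then S else sx S [set x].
have set_xP a : x \in set_x a = a.
  by rewrite /set_x; case: ifP => [/eqP //|]; rewrite in_sx1 eqxx; case: a; case: (x \in S).
have set_xU a : U (set_x a) = U S by rewrite /set_x; case: ifP.
have set_xD a : set_x a :\ x = S :\ x.
  by apply/eqP; rewrite /set_x eqD1; case: ifP; rewrite eqxx ?orbT.
have := congr1 (fun A => ent A (set_x b) (set_x b')) h.
rewrite ent_gmux ent1 !set_xD eqxx !set_xP set_xU mxE bit_eq => ->; congr (_ %:R).
case: (b =P b') => [->|ne]; rewrite ?eqxx //.
by case: eqP => // e; case: ne; rewrite -(set_xP b) e set_xP.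
Qed.

Lemma adj_gmux x (U : cfg -> 'M[C]_2) : (forall S, U (sx S [set x]) = U S) ->
  adj (gmux x U) = gmux x (fun S => adj (U S)).
Proof.
move=> hU; apply: entP => T S; rewrite ent_adj !ent_gmux eq_sym.
case: ifP; last by rewrite rmorph0.
by rewrite eqD1 => /orP[] /eqP ->; rewrite adjE ?hU.
Qed.

Definition cnf c t S : cfg := if c \in S then sx S [set t] else S.
Definition cn c t : Op := mono (cnf c t) (fun=> 1).

Lemma gate_op_CNOT c t : gate_op (CNOT R c t) = cn c t.
Proof. by apply: entP => T S; rewrite !ent_mkop /cnf flipqE. Qed.

Lemma in_cnf z c t S : (z \in cnf c t S) = (z \in S) (+) ((c \in S) && (z == t)).
Proof. by rewrite /cnf; case: ifP => _; rewrite ?in_sx1 ?addbF. Qed.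

Lemma cnfK c t : c != t -> involutive (cnf c t).
Proof.
move=> /negPf ne S; apply/setP=> z; rewrite !in_cnf ne andbF addbF.
by case: (z \in S); case: (c \in S); case: (z == t).
Qed.

Lemma adj_cn c t : c != t -> adj (cn c t) = cn c t.
Proof. by move=> /cnfK h; rewrite adj_mono //; apply: eq_mono => // S; rewrite rmorph1. Qed.

Lemma cnK c t : c != t -> cn c t *m cn c t = 1%:M.
Proof. by move=> /cnfK h; rewrite mono_mul -mono1; apply: eq_mono => // S; rewrite mulr1. Qed.

Lemma unitary_cn c t : c != t -> unitary (cn c t).
Proof. by move=> h; split; rewrite adj_cn // cnK. Qed.

Lemma distnn' (a : nat) : distn' a a = 0%N.
Proof. by rewrite /distn' subnn. Qed.

Lemma dist1_neq x y : (0 < dist1 x y)%N -> x != y.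
Proof. by apply: contraTneq => ->; rewrite /dist1 !distnn'. Qed.

Lemma unitary_gate a : gate_ok a -> unitary (@gate_op R L a).
Proof.
case: a => [x U [u1 u2]|c t h]; last first.
  by rewrite gate_op_CNOT; apply: unitary_cn; apply: dist1_neq; rewrite h.
rewrite gate_op_G1; split; rewrite adj_gmux // gmux_mul // -(gmux1 x);
  by congr gmux; apply/funext => S.
Qed.

Definition inv_gate (a : gate) : gate :=
  match a with G1 x U => G1 x (adj U) | CNOT c t => CNOT R c t end.

Lemma inv_gate_ok a : gate_ok a -> gate_ok (inv_gate a).
Proof. by case: a => //= x U [u1 u2]; split; rewrite adjK. Qed.

Lemma inv_gate_op a : gate_ok a -> gate_op (inv_gate a) = adj (gate_op a).
Proof.
case: a => [x U _|c t h]; first by rewrite !gate_op_G1 adj_gmux.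
by rewrite !gate_op_CNOT adj_cn //; apply: dist1_neq; rewrite h.
Qed.

(** [A] is an operator on the qubits of [X] tensored with the identity: it changes no bit outside
    [X], and its entries do not depend on those bits. *)
Definition localop A (X : pred (site L)) :=
  (forall T S z, ent A T S != 0 -> z \in sx T S -> X z) /\
  (forall F T S, (forall z, z \in F -> ~~ X z) -> ent A (sx T F) (sx S F) = ent A T S).

Lemma localop_comm A B (X Y : pred (site L)) : localop A X -> localop B Y ->
  (forall z, X z -> ~~ Y z) -> A *m B = B *m A.
Proof.
move=> [a1 a2] [b1 b2] dXY; apply: entP => T S; rewrite !ent_mul.
(* A path from [S] to [T] through [W] makes the move of [B] and then that of [A]. Making the same
   two moves in the other order passes through [T + W + S], which matches the terms of the two
   sums. *)
have hK : involutive (fun W => sx (sx T W) S).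
  by move=> W; apply/setP=> z; rewrite !in_sx; case: (z \in T); case: (z \in W); case: (z \in S).
rewrite [RHS](reindex_inj (inv_inj hK)); apply: eq_bigr => W _.
have kA : (forall z, z \in sx W S -> ~~ X z) -> ent A (sx (sx T W) S) S = ent A T W.
  move=> h; rewrite -(a2 _ _ _ h); f_equal; apply/setP=> z; rewrite !in_sx;
  by case: (z \in T); case: (z \in W); case: (z \in S).
have kB : (forall z, z \in sx T W -> ~~ Y z) -> ent B T (sx (sx T W) S) = ent B W S.
  move=> h; rewrite -[RHS](b2 _ _ _ h); f_equal; apply/setP=> z; rewrite !in_sx;
  by case: (z \in T); case: (z \in W); case: (z \in S).
have hWS : sx T (sx (sx T W) S) = sx W S.
  by apply/setP=> z; rewrite !in_sx; case: (z \in T); case: (z \in W); case: (z \in S).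
have hTW : sx (sx (sx T W) S) S = sx T W by rewrite sxK.
have [eA|hA] := eqVneq (ent A T W) 0; have [eB|hB] := eqVneq (ent B W S) 0.
- rewrite eA mul0r; have [->|h] := eqVneq (ent B T (sx (sx T W) S)) 0; first by rewrite mul0r.
  rewrite kA ?eA ?mulr0 // => z hz; apply/negP=> /dXY /negP; apply.
  by apply: (b1 _ _ z h); rewrite hWS.
- rewrite eA mul0r kA ?eA ?mulr0 // => z hz; apply/negP=> /dXY /negP; apply.
  exact: (b1 _ _ z hB).
- rewrite eB mulr0 kB ?eB ?mul0r // => z hz; apply: dXY.
  exact: (a1 _ _ z hA).
rewrite mulrC kA ?kB // => z hz; first by apply: dXY; apply: (a1 _ _ z hA).
by apply/negP=> /dXY /negP; apply; apply: (b1 _ _ z hB).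
Qed.

Lemma eq_sx T S F : (sx T F == sx S F) = (T == S).
Proof. exact: (can_eq (sxK F)). Qed.

Lemma localop_gate a : localop (@gate_op R L a) (mem (gate_support a)).
Proof.
case: a => [x U|c t]; [rewrite gate_op_G1|rewrite gate_op_CNOT]; split.
- move=> T S z; rewrite ent_gmux eqD1; case: ifP; last by rewrite eqxx.
  move=> /orP[]/eqP -> _; rewrite in_sx; first by rewrite addbb.
  by rewrite in_sx1 addbAC addbb => zx; rewrite /= inE.
- move=> F T S hF; have hx : x \in F = false.
    by apply/negP=> /hF; rewrite /= inE eqxx.
  rewrite !ent_gmux !eqD1 !in_sx hx !addbF sxAC.
  by rewrite !eq_sx.
- move=> T S z; rewrite ent_mono; case: ifP => [/eqP ->|]; last by rewrite eqxx.
  by rewrite in_sx in_cnf addbAC addbb => _ /andP[_ zt]; rewrite /= !inE zt orbT.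
- move=> F T S hF; have hx : c \in F = false.
    by apply/negP=> /hF; rewrite /= !inE eqxx.
  rewrite !ent_mono /cnf in_sx hx addbF sxAC; by case: (c \in S); rewrite eq_sx.
Qed.

End Circuits.

(** * Sequential implementation and parallel composition *)

HB.instance Definition _ (R : realType) (L : nat) := gen_eqMixin (gate R L).

Section Implementable.
Variables (R : realType) (L : nat).
Local Notation C := R[i].
Local Notation cfg := (cfg L).
Local Notation Op := (Op R L).
Local Notation gate := (gate R L).
Local Notation circuit := (circuit R L).
Local Notation cn := (@cn R L).
Implicit Types (S T F : cfg) (A B U V : Op) (x y z w c : site L) (g : seq gate) (Q : pred (site L)).

Definition supp_in Q (a : gate) := forall z, z \in gate_support a -> Q z.

(** A sequential notion: [k] bounds the number of gates and also the depth when one gate is run per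
    layer. Parallelism enters only in [impl_par], through the region [Q]. *)
Definition impl Q k U := exists g,
  [/\ (forall a, a \in g -> gate_ok a), (forall a, a \in g -> supp_in Q a),
      (size g <= k)%N & gops g = U].

Lemma impl_leq Q k k' U : (k <= k')%N -> impl Q k U -> impl Q k' U.
Proof. by move=> h [g [h1 h2 h3 h4]]; exists g; split=> //; apply: leq_trans h. Qed.

Lemma impl1 Q : impl Q 0 1%:M.
Proof. by exists [::]. Qed.

Lemma impl_mul Q k1 k2 U1 U2 : impl Q k1 U1 -> impl Q k2 U2 -> impl Q (k1 + k2) (U1 *m U2).
Proof.
move=> [g1 [a1 b1 c1 <-]] [g2 [a2 b2 c2 <-]]; exists (g2 ++ g1); split.
- by move=> a; rewrite mem_cat => /orP[/a2|/a1].
- by move=> a; rewrite mem_cat => /orP[/b2|/b1].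
- by rewrite size_cat addnC leq_add.
by rewrite /gops map_cat tprod_cat.
Qed.

Lemma impl_tprod Q k (s : seq Op) : (forall A, A \in s -> impl Q k A) ->
  impl Q (size s * k) (tprod s).
Proof.
elim: s => [|A s IH] h /=; first exact: impl1.
rewrite mulSn addnC; apply: impl_mul; last by apply: h; rewrite inE eqxx.
by apply: IH => B hB; apply: h; rewrite inE hB orbT.
Qed.

Lemma impl_gate Q a : gate_ok a -> supp_in Q a -> impl Q 1 (gate_op a).
Proof.
move=> h1 h2; exists [:: a]; split=> //; try by move=> b; rewrite inE => /eqP ->.
by rewrite /gops /= mul1mx.
Qed.

Lemma impl_adj Q k U : impl Q k U -> impl Q k (adj U).
Proof.
move=> [g [h1 h2 h3 <-]]; exists (rev (map (@inv_gate R L) g)); split.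
- by move=> a; rewrite mem_rev => /mapP[b hb ->]; apply: inv_gate_ok; apply: h1.
- by move=> a; rewrite mem_rev => /mapP[b /h2 hb ->] z; case: b hb => [x V|c t] hb; apply: hb.
- by rewrite size_rev size_map.
elim: g h1 {h2 h3} => [|a g IH] h1; first by rewrite /gops /= adj_id.
rewrite /= rev_cons /gops map_rcons tprod_rcons /= adj_mul inv_gate_op; last first.
  by apply: h1; rewrite inE eqxx.
by rewrite -/(gops _) IH // => b hb; apply: h1; rewrite inE hb orbT.
Qed.

Lemma impl_unitary Q k U : impl Q k U -> unitary U.
Proof.
move=> [g [h1 _ _ <-]]; elim: g h1 => [|a g IH] h1; first exact: unitary1.
apply: unitary_mul; first by apply: IH => b hb; apply: h1; rewrite inE hb orbT.
by apply: unitary_gate; apply: h1; rewrite inE eqxx.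
Qed.

(** Runs [g], one gate per layer, alongside [cc]: gate counts add up while the depth is a
    maximum. *)
Fixpoint stack (cc : circuit) g : circuit :=
  if g is a :: g' then
    if cc is l :: cc' then (a :: l) :: stack cc' g' else [:: a] :: stack [::] g'
  else cc.

Lemma size_stack cc g : size (stack cc g) = maxn (size cc) (size g).
Proof.
elim: g cc => [|a g IH] [|l cc] //=; rewrite ?maxn0 // IH ?max0n //.
by rewrite maxnSS.
Qed.

Lemma gate_count_stack cc g : gate_count (stack cc g) = (gate_count cc + size g)%N.
Proof.
rewrite /gate_count; elim: g cc => [|a g IH] [|l cc] //=; rewrite ?addn0 // IH /=; lia.
Qed.

Lemma mem_stack (cc : circuit) g (l : layer R L) a : l \in stack cc g -> a \in l ->
  (exists2 l', l' \in cc & a \in l') \/ a \in g.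
Proof.
elim: g cc => [|b g IH] [|l0 cc] //=; first by move=> h1 h2; left; exists l.
  rewrite in_cons => /orP[/eqP ->|h1 h2].
    by rewrite mem_seq1 => h; right; rewrite in_cons h.
  by case: (IH _ h1 h2) => [[l' //]|h]; right; rewrite in_cons h orbT.
rewrite in_cons => /orP[/eqP ->|h1 h2].
  rewrite in_cons => /orP[h|h]; first by right; rewrite in_cons h.
  by left; exists l0; rewrite ?in_cons ?eqxx.
case: (IH _ h1 h2) => [[l' hl' h]|h]; last by right; rewrite in_cons h orbT.
by left; exists l'; rewrite ?in_cons ?hl' ?orbT.
Qed.

Definition disj_supp (a b : gate) := forall z, z \in gate_support a -> z \notin gate_support b.

Lemma gate_comm a b : disj_supp a b -> gate_op a *m gate_op b = gate_op b *m gate_op a.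
Proof. by move=> h; apply: (localop_comm (localop_gate a) (localop_gate b)). Qed.

Lemma layer_op_cons a (l : layer R L) : layer_op (a :: l) = gate_op a *m layer_op l.
Proof. by []. Qed.

Lemma circ_op_cons (l : layer R L) cc : circ_op (l :: cc) = circ_op cc *m layer_op l.
Proof. by []. Qed.

Lemma gate_comm_circ a (cc : circuit) : (forall l b, l \in cc -> b \in l -> disj_supp a b) ->
  gate_op a *m circ_op cc = circ_op cc *m gate_op a.
Proof.
elim: cc => [|l cc IH] h; first by rewrite /circ_op /= mulmx1 mul1mx.
rewrite circ_op_cons mulmxA IH; last first.
  by move=> l' b hl'; apply: h; rewrite inE hl' orbT.
rewrite -!mulmxA; congr (_ *m _).
have : forall b, b \in l -> disj_supp a b by move=> b; apply: h; rewrite inE eqxx.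
elim: l {h} => [|b l IHl] h; first by rewrite /layer_op /= mulmx1 mul1mx.
rewrite layer_op_cons mulmxA gate_comm; last by apply: h; rewrite inE eqxx.
by rewrite -!mulmxA IHl // => b' hb'; apply: h; rewrite inE hb' orbT.
Qed.

Lemma circ_op_stack (cc : circuit) g : (forall l a b, l \in cc -> b \in l -> a \in g -> disj_supp a b) ->
  circ_op (stack cc g) = gops g *m circ_op cc.
Proof.
elim: g cc => [|a g IH] [|l cc] h; rewrite /stack -/stack.
- by rewrite /gops /= mul1mx.
- by rewrite /gops /= mul1mx.
- rewrite circ_op_cons IH // /circ_op /= /layer_op /= !mulmx1.
  by rewrite /gops /= .
rewrite !circ_op_cons IH; last first.
  by move=> l' a' b hl' hb ha; apply: (h l'); rewrite // inE ?hl' ?ha orbT.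
rewrite layer_op_cons [gops (a :: g)]/=.
rewrite /gops /= -/(tprod _) -/(gops _) -!mulmxA; congr (_ *m _).
rewrite !mulmxA gate_comm_circ // => l' b hl' hb; apply: (h l') => //.
  by rewrite inE hl' orbT.
by rewrite inE eqxx.
Qed.

Lemma gate_support_uniq a : gate_ok a -> uniq (@gate_support R L a).
Proof. by case: a => //= c t h; rewrite inE andbT dist1_neq // h. Qed.

Lemma circuit_ok_stack (cc : circuit) g : circuit_ok cc -> (forall a, a \in g -> gate_ok a) ->
  (forall l a b, l \in cc -> b \in l -> a \in g -> disj_supp a b) ->
  circuit_ok (stack cc g).
Proof.
elim: g cc => [|a g IH] [|l cc] // hc hg hd; rewrite /stack -/stack /circuit_ok /=.
  split; last by apply: IH => // b hb; apply: hg; rewrite inE hb orbT.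
  have ha : gate_ok a by apply: hg; rewrite inE eqxx.
  by split=> //=; rewrite cats0 gate_support_uniq.
case: hc => -[hl1 hl2] hc; split; last first.
  apply: IH => // [b hb|l' a' b hl' hb ha]; first by apply: hg; rewrite inE hb orbT.
  by apply: (hd l'); rewrite // inE ?hl' ?ha orbT.
have ha : gate_ok a by apply: hg; rewrite inE eqxx.
split=> //=; rewrite cat_uniq gate_support_uniq // hl2 andbT /=.
apply/hasPn=> z /flatten_mapP[b hb hz]; apply/negP=> hz'.
have hd' : disj_supp a b by apply: (hd l); rewrite // inE eqxx.
by have := hd' _ hz'; rewrite hz.
Qed.

(** The regions are fibres of [f], hence pairwise disjoint, and the sequential programs can be
    stacked without collisions. *)
Lemma impl_par n M (f : site L -> nat) (U : nat -> Op) :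
  (forall t : nat, (t < n)%N -> impl (fun z => f z == t) M (U t)) ->
  exists V : circuit, [/\ circuit_ok V, (gate_count V <= n * M)%N, (depth V <= M)%N &
    circ_op V = tprod (map U (iota 0 n))].
Proof.
move=> h.
(* The additional last clause confines the gates placed so far to regions of index below [n], so
   that the program of region [n] is disjoint from them. *)
suff [V [h1 h2 h3 h4 _]] : exists V : circuit, [/\ circuit_ok V, (gate_count V <= n * M)%N,
    (depth V <= M)%N, circ_op V = tprod (map U (iota 0 n)) &
    forall l a z, l \in V -> a \in l -> z \in gate_support a -> (f z < n)%N].
  by exists V.
elim: n h => [|n IH] h; first by exists [::].
have [V [h1 h2 h3 h4 h5]] := IH (fun t ht => h t (ltnW ht)).
have [g [g1 g2 g3 g4]] := h n (ltnSn n).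
have hd l a b : l \in V -> b \in l -> a \in g -> disj_supp a b.
  move=> hl hb ha z hz; apply/negP=> /(h5 _ _ _ hl hb).
  by have /eqP -> := g2 a ha z hz; rewrite ltnn.
exists (stack V g); split.
- exact: circuit_ok_stack.
- by rewrite gate_count_stack mulSn addnC leq_add.
- by rewrite /depth size_stack geq_max h3.
- by rewrite circ_op_stack // h4 g4 -addn1 iotaD map_cat tprod_cat /= mul1mx.
move=> l a z hl ha hz; have [[l' hl' ha']|ha'] := mem_stack hl ha.
  exact: ltnW (h5 _ _ _ hl' ha' hz).
by have /eqP -> := g2 a ha' z hz.
Qed.

End Implementable.

(** * Two-qubit unitaries *)

Section TwoQubit.
Variables (R : realType) (L : nat).
Local Notation C := R[i].
Local Notation cfg := (cfg L).
Local Notation Op := (Op R L).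
Local Notation gate := (gate R L).
Local Notation cn := (@cn R L).
Local Notation mono := (@mono R L).
Variables (f : nat -> nat) (t : nat).
Hypothesis f_homo : {homo f : a b / (a <= b)%N}.
Local Notation Q := (fun z : site L => f z.1 == t).
Implicit Types (S T F : cfg) (A B U V : Op) (x y z w c : site L).

Lemma ord_shift (a b : 'I_L) : (a : nat) != b ->
  exists e : 'I_L, [/\ distn' e b = 1%N, (distn' a e).+1 = distn' a b &
     (minn a b <= e <= maxn a b)%N].
Proof.
move=> ne; have [hab|hab] : (a < b)%N \/ (b < a)%N by lia.
  have he : (b.-1 < L)%N by have := ltn_ord b; lia.
  exists (Ordinal he); rewrite /distn' /=; split; lia.
have he : (b.+1 < L)%N by have := ltn_ord a; lia.
by exists (Ordinal he); rewrite /distn' /=; split; lia.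
Qed.

Lemma distn'_eq0 (a b : 'I_L) : (distn' a b == 0)%N = (a == b).
Proof. by rewrite -(inj_eq val_inj) /distn' /=; apply/idP/idP; lia. Qed.

(** The neighbour of [y] is taken along the row while the columns differ, then along the column. In
    the latter case the new row lies between two rows of the region, and monotonicity of [f] keeps
    it inside. *)
Lemma path_step x y : Q x -> Q y -> (1 < dist1 x y)%N ->
  exists z, [/\ Q z, dist1 z y = 1%N & (dist1 x z).+1 = dist1 x y].
Proof.
case: x y => [x1 x2] [y1 y2] /= /eqP hx /eqP hy; rewrite /dist1 /= => hd.
have [e2|n2] := eqVneq (x2 : nat) y2; last first.
  have [e [h1 h2 _]] := ord_shift n2.
  by exists (y1, e); rewrite /= hy eqxx; split=> //; rewrite ?distnn' ?h1 // -h2; lia.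
have n1 : (x1 : nat) != y1 by apply: contraTneq hd => e; rewrite /distn'; lia.
have [e [h1 h2 /andP[h3 h4]]] := ord_shift n1.
exists (e, y2); rewrite /= ?distnn' ?h1; split=> //; last by rewrite -h2; lia.
have [hxy|hxy] := leqP x1 y1.
  rewrite (minn_idPl hxy) in h3; rewrite (maxn_idPr hxy) in h4.
  by rewrite eqn_leq -{1}hy -hx !f_homo.
have hyx := ltnW hxy.
rewrite (minn_idPr hyx) in h3; rewrite (maxn_idPl hyx) in h4.
by rewrite eqn_leq -{1}hx -hy !f_homo.
Qed.

Lemma cn_commutator x b y : x != b -> b != y -> x != y ->
  cn b y *m cn x b *m cn b y *m cn x b = cn x y.
Proof.
move=> /negPf h1 /negPf h2 /negPf h3; rewrite !mono_mul; apply: eq_mono => S; last by rewrite !mulr1.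
apply/setP=> z; rewrite !in_cnf !eqxx !h1 !h2 !h3 !andbF !addbF !andbT.
case: (eqVneq z y) => [->|_]; rewrite ?(eq_sym y b) ?h2 ?andbF ?addbF ?andbT.
  by case: (y \in S); case: (b \in S); case: (x \in S).
by case: (z \in S); case: (b \in S); case: (x \in S); case: (z == b).
Qed.

(** A distant CNOT is a commutator of CNOTs through a neighbour [b] of [y], which restores [b]. The
    cost recursion is [2 * 4 ^ d + 2], at most [4 ^ d.+1]. *)
Lemma impl_cn d x y : Q x -> Q y -> x != y -> (dist1 x y <= d)%N ->
  impl Q (4 ^ d) (cn x y).
Proof.
elim: d x y => [|d IH] x y hx hy nxy hd.
  move: hd; rewrite leqn0 /dist1 addn_eq0 !distn'_eq0 => /andP[/eqP e1 /eqP e2].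
  by case: x y e1 e2 nxy {hx hy} => [x1 x2] [y1 y2] /= -> ->; rewrite eqxx.
have hd0 : (0 < dist1 x y)%N.
  rewrite lt0n /dist1 addn_eq0 !distn'_eq0; apply: contra nxy => /andP[/eqP e1 /eqP e2].
  by rewrite -pair_eqE /= e1 e2 !eqxx.
have base u v : Q u -> Q v -> dist1 u v = 1%N -> impl Q 1 (cn u v).
  move=> hu hv huv; rewrite -gate_op_CNOT; apply: impl_gate => //= w.
  by rewrite !inE => /orP[]/eqP ->.
have [h1|h1] := leqP (dist1 x y) 1.
  by apply: (impl_leq _ (base _ _ hx hy _)); rewrite ?expn_gt0 //; lia.
have [b [hb hby hxb]] := path_step hx hy h1.
have nby : b != y by apply: dist1_neq; rewrite hby.
have nxb : x != b by apply: dist1_neq; lia.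
rewrite -(cn_commutator nxb nby nxy).
apply: (@impl_leq _ _ _ (1 + 4 ^ d + 1 + 4 ^ d)).
  by have : (0 < 4 ^ d)%N by [rewrite expn_gt0]; rewrite expnS; lia.
by do 3 (apply: impl_mul; last by [apply: IH => //; lia|apply: base]); apply: base.
Qed.

(** * Controlled phases, multiplexed gates and parity-preserving two-qubit unitaries *)

Definition phase2 (r : C) : 'M[C]_2 := diag_mx (\row_i (if i == bit true then r else 1)).

Lemma gate_phase x (r : C) : gate_op (G1 x (phase2 r)) = mono id (fun S => if x \in S then r else 1).
Proof.
apply: entP => T S; rewrite gate_op_G1 ent_gmux ent_mono eqD1 !mxE !bit_eq.
case: (T =P S) => [->|ne] /=; first by rewrite eqxx mulr1n; case: (x \in S).
by case: eqP => // ->; rewrite in_sx1 eqxx; case: (x \in S).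
Qed.

Lemma impl_phase x (r : C) : Q x -> r * conjc r = 1 ->
  impl Q 1 (mono id (fun S => if x \in S then r else 1)).
Proof.
move=> hx hr; rewrite -gate_phase; apply: impl_gate; last by move=> z; rewrite inE => /eqP ->.
split; apply/matrixP=> i j; have [b ->] := bitP i; have [c ->] := bitP j;
rewrite /phase2 ?mul_diag_mx ?mul_mx_diag !mxE !bit_eq;
case: b; case: c; rewrite /= ?oppr0 -?[Complex 0 0]/(0 : C) -?[Complex 1 0]/(1 : C)
  ?mulr0 ?mul0r ?mulr1 ?hr //.
by rewrite mulrC.
Qed.

Lemma conjc_unit (r : C) : r * conjc r = 1 -> conjc r * conjc (conjc r) = 1.
Proof. by rewrite conjcK mulrC. Qed.

(* n_x n_y = (n_x + n_y - (n_x xor n_y)) / 2 *)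
Lemma impl_cphase d x y (r : C) : Q x -> Q y -> x != y -> (dist1 x y <= d)%N ->
  r * conjc r = 1 ->
  impl Q (4 ^ d * 2 + 3) (mono id (fun S => if (x \in S) && (y \in S) then r * r else 1)).
Proof.
move=> hx hy nxy hd hr.
have -> : mono id (fun S => if (x \in S) && (y \in S) then r * r else 1) =
   mono id (fun S => if x \in S then r else 1) *m mono id (fun S => if y \in S then r else 1) *m
   (cn x y *m mono id (fun S => if y \in S then conjc r else 1) *m cn x y).
  rewrite !mono_mul; apply: eq_mono => S; first by rewrite cnfK.
  rewrite cnfK // !in_cnf eqxx andbT.
  by case: (x \in S); case: (y \in S); rewrite /= ?mulr1 ?mul1r // ?hr // -mulrA ?hr ?mulr1.
apply: (@impl_leq _ _ _ (1 + 1 + (4 ^ d + 1 + 4 ^ d))); first lia.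
do ?apply: impl_mul; first [exact: impl_cn | apply: impl_phase => //].
exact: conjc_unit.
Qed.

Lemma impl_cz d x y : Q x -> Q y -> x != y -> (dist1 x y <= d)%N ->
  impl Q (4 ^ d * 2 + 3) (mono id (fun S => (-1) ^+ ((x \in S) && (y \in S)))).
Proof.
move=> hx hy nxy hd.
have hi : ('i%C : C) * conjc 'i%C = 1.
  by apply/eqP; rewrite eq_complex /= !mul0r !mulr0 mulrN mulr1 opprK add0r addr0 !eqxx.
have := impl_cphase hx hy nxy hd hi.
congr (impl Q _ _); apply: eq_mono => // S.
by case: (_ && _); rewrite // -expr2 sqr_i expr1.
Qed.

Lemma unit_root (a : C) : a * conjc a = 1 -> exists2 r : C, r * conjc r = 1 & r * r = a.
Proof.
move=> ha; exists (sqrtc a); last by rewrite -expr2 sqr_sqrtc.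
set r := sqrtc a; have e : r * r = a by rewrite -expr2 sqr_sqrtc.
have : (r * conjc r) ^+ 2 = 1 by rewrite -ha -e conjcM; ring.
move=> /eqP; rewrite sqrf_eq1 => /orP[/eqP //|/eqP h].
by have := mulcJ_ge0 r; rewrite h oppr_ge0 ler10.
Qed.

(** Apply [U0] always and [W = U1 *m adj U0] under control of [y]. Diagonalizing [W] turns the
    controlled part into a phase on [y] and a controlled phase, between one-qubit gates on [x]. *)
Lemma impl_mux d x y (U0 U1 : 'M[C]_2) : Q x -> Q y -> x != y -> (dist1 x y <= d)%N ->
  unitary U0 -> unitary U1 ->
  impl Q (4 ^ d * 2 + 6) (gmux x (fun S => if y \in S then U1 else U0)).
Proof.
move=> hx hy nxy hd [a1 a2] [b1 b2].
have [W WE] : exists W, W = U1 *m adj U0 by exists (U1 *m adj U0).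
have [w1 w2] : unitary W.
  split; rewrite WE adjM adjK -!mulmxA.
    by rewrite (mulmxA (adj U0)) a2 mul1mx b1.
  by rewrite (mulmxA (adj U1)) b2 mul1mx a1.
have [P [e [[p1 p2] eW]]] : exists (P : 'M[C]_2) (e : 'rV[C]_2), unitary P /\ W = adj P *m diag_mx e *m P.
  by apply: normal_diagonalization; rewrite w1 w2.
have eU i : e 0 i * conjc (e 0 i) = 1.
  have eD : diag_mx e = P *m W *m adj P by rewrite eW -!mulmxA p1 mulmx1 !mulmxA p1 mul1mx.
  have : diag_mx e *m adj (diag_mx e) = 1%:M.
    rewrite eD !adjM adjK -!mulmxA (mulmxA (adj P) P) p2 mul1mx (mulmxA W) w1 mul1mx.
    by rewrite p1.
  by move=> /(congr1 (fun M : 'M[C]_2 => M i i)); rewrite mul_diag_mx !mxE eqxx !mulr1n.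
pose e0 := e 0 (bit false); pose e1 := e 0 (bit true).
(* [impl_cphase] yields the square of its parameter, so a unit square root of the relative phase of
   the two eigenvalues is required. *)
have [r hr er] : exists2 r : C, r * conjc r = 1 & r * r = e1 * conjc e0.
  apply: unit_root; rewrite conjcM conjcK; have := eU (bit false); have := eU (bit true).
  by rewrite -/e0 -/e1 => h1 h0; rewrite mulrACA h1 mul1r mulrC h0.
have sy S : (y \in sx S [set x]) = (y \in S) by rewrite in_sx1 eq_sym (negPf nxy) addbF.
pose D S : 'M[C]_2 := if y \in S then diag_mx e else 1%:M.
have DE : gmux x D = mono id (fun S => if y \in S then e0 else 1) *m
    mono id (fun S => if (x \in S) && (y \in S) then r * r else 1).
  rewrite mono_mul; apply: entP => T S; rewrite ent_gmux ent_mono eqD1 /D.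
  case: (T =P S) => [->|ne] /=.
    case: (y \in S); rewrite !mxE eqxx !mulr1n ?andbF ?mulr1 // andbT; case: (x \in S).
      by rewrite er mulrCA -/e1 (eU (bit false)) mulr1.
    by rewrite mulr1.
  case: (T =P sx S [set x]) => // ->; rewrite in_sx1 eqxx addbT.
  by case: (y \in S); rewrite !mxE bit_eq; case: (x \in S).
have -> : gmux x (fun S => if y \in S then U1 else U0) =
    gate_op (G1 x (adj P)) *m gmux x D *m gate_op (G1 x (P *m U0)).
  rewrite !gate_op_G1 !gmux_mul //; last by move=> S; rewrite /D sy.
  congr gmux; apply/funext => S; rewrite /D; case: (y \in S).
    by rewrite mulmxA -eW WE -mulmxA a2 mulmx1.
  by rewrite mulmx1 mulmxA p2 mul1mx.
have hs (U : 'M[C]_2) : supp_in Q (G1 x U) by move=> z; rewrite inE => /eqP ->.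
rewrite DE; apply: (@impl_leq _ _ _ (1 + (1 + (4 ^ d * 2 + 3)) + 1)); first lia.
apply: impl_mul; last first.
  apply: impl_gate => //; split; rewrite adjM -!mulmxA.
    by rewrite (mulmxA U0) a1 mul1mx p1.
  by rewrite (mulmxA (adj P)) p2 mul1mx a2.
apply: impl_mul; first by apply: impl_gate => //; split; rewrite adjK.
by apply: impl_mul; [apply: impl_phase => //; exact: eU | exact: impl_cphase].
Qed.

(** The CNOT from [x] to [y] writes the parity of the pair into [y]. Since [A] preserves this
    parity, the conjugated operator acts on [x] alone, with [y] as a control. *)
Lemma impl_two_qubit d x y A : Q x -> Q y -> x != y -> (dist1 x y <= d)%N ->
  unitary A -> localop A (fun z => (z == x) || (z == y)) ->
  (forall T S, ent A T S != 0 -> (x \in T) (+) (y \in T) = (x \in S) (+) (y \in S)) ->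
  impl Q (4 ^ d * 4 + 6) A.
Proof.
move=> hx hy nxy hd uA [A1 A2] Apar.
have nyx : y != x by rewrite eq_sym.
(* The configuration on the two sites with bit [b] at [x] and total parity [p]. *)
pose bs (p b : bool) : cfg := [set z | ((z == x) && b) || ((z == y) && (b (+) p))].
pose U S : 'M[C]_2 := \matrix_(i, j) ent A (bs (y \in S) (i == bit true)) (bs (y \in S) (j == bit true)).
have UE S : U S = if y \in S then U [set: site L] else U finset.set0.
  by rewrite /U !inE; case: (y \in S).
have sy S : (y \in sx S [set x]) = (y \in S) by rewrite in_sx1 (negPf nyx) addbF.
have eB : cn x y *m A *m cn x y = gmux x U.
  apply: entP => T S; rewrite ent_mul_mono mulr1 ent_mono_mul ?mul1r; last exact: cnfK.
  rewrite ent_gmux mxE !bit_eq !eqb_id.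
  have key (W : cfg) (q : bool) : q = (y \in W) -> cnf x y W =
     sx (bs q (x \in W)) [set z in W | (z != x) && (z != y)].
    move=> ->; apply/setP=> z; rewrite in_cnf in_sx !inE.
    case: (eqVneq z x) => [->|nzx]; first by rewrite (negPf nxy); case: (x \in W).
    case: (eqVneq z y) => [->|nzy]; last by case: (z \in W); case: (x \in W).
    by case: (x \in W); case: (y \in W).
  case: ifP => h.
    have hz z : z != x -> (z \in T) = (z \in S).
      by move=> nz; have := congr1 (fun X : cfg => z \in X) (eqP h); rewrite /= !inE nz.
    have hy' : (y \in S) = (y \in T) by rewrite hz.
    rewrite (key T _ hy') (key S _ erefl).
    have -> : [set z in T | (z != x) && (z != y)] = [set z in S | (z != x) && (z != y)].
      by apply/setP=> z; rewrite !inE; case: (eqVneq z x) => [|/hz ->] //=; rewrite !andbF.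
    by apply: A2 => z; rewrite !inE negb_or => /andP[].
  apply/eqP; rewrite -[_ == 0]negbK; apply/negP=> h0; move/negP: h; apply.
  have hp := Apar _ _ h0; have ha := A1 _ _ _ h0.
  rewrite !in_cnf !eqxx (negPf nxy) !andbF !addbF !andbT in hp.
  apply/eqP/setP=> z; rewrite !inE; case: (eqVneq z x) => //= nzx.
  case: (eqVneq z y) => [->|nzy].
    by move: hp; case: (x \in T); case: (x \in S); case: (y \in T); case: (y \in S).
  apply/eqP; apply: contraTT isT => hne; have := ha z; rewrite in_sx !in_cnf (negPf nzx) (negPf nzy).
  rewrite !andbF !addbF /=; case: (z \in T) hne; case: (z \in S) => //= _ /(_ isT) //.
have nxyK := cnK R nxy.
have uB : unitary (gmux x U).
  by rewrite -eB; do !apply: unitary_mul => //; exact: unitary_cn.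
have hU S : U (sx S [set x]) = U S by rewrite /U sy.
have uU S : unitary (U S).
  case: uB => u1 u2; rewrite adj_gmux // in u1 u2; split.
    by apply: (@gmux1_inj _ _ x (fun S => U S *m adj (U S))) => [S'|]; rewrite ?hU // -gmux_mul.
  apply: (@gmux1_inj _ _ x (fun S => adj (U S) *m U S)) => [S'|]; rewrite ?hU // -gmux_mul // => S'.
  by rewrite hU.
have -> : A = cn x y *m gmux x U *m cn x y.
  by rewrite -eB -!mulmxA nxyK mulmx1 !mulmxA nxyK mul1mx.
have -> : gmux x U = gmux x (fun S => if y \in S then U [set: site L] else U finset.set0).
  by congr gmux; apply/funext => S; exact: UE.
apply: (@impl_leq _ _ _ (4 ^ d + (4 ^ d * 2 + 6) + 4 ^ d)); first lia.
do 2?[apply: impl_mul]; by [exact: impl_cn | exact: impl_mux].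
Qed.

End TwoQubit.

(** * Evolution of one pair *)

Section PairGate.
Variables (R : realType) (L : nat).
Local Notation C := R[i].
Local Notation cfg := (cfg L).
Local Notation Op := (Op R L).
Local Notation mono := (@mono R L).
Local Notation flad := (ladder R (fun z : site L => enum_rank z)).
Implicit Types (S T F : cfg) (A B U V : Op) (x y z w : site L) (m : ordering L).

Lemma nopE x : nop R x = mono id (fun S => (x \in S)%:R).
Proof. by rewrite /nop ccreE cannE ladder_num. Qed.

Definition pz x y S : C := (-1) ^+ ((x \in S) (+) (y \in S)).

Lemma parityE x y : parity R x y = mono id (pz x y).
Proof.
have h z : 1%:M - 2%:R *: nop R z = mono id (fun S => (-1) ^+ (z \in S)).
  apply: entP => T S; rewrite nopE ent_add ent_opp ent_scale ent1 !ent_mono /=.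
  case: (T =P S) => [_|_]; last by rewrite mulr0 subr0.
  by case: (z \in S); rewrite ?mulr1 ?mulr0 ?subr0 ?expr1 //=; ring.
rewrite /parity (h x) (h y) mono_mul; apply: eq_mono => [//|S].
by rewrite /pz signr_addb.
Qed.

Lemma parity_ladder x y z b : x != y -> (z == x) || (z == y) ->
  parity R x y *m flad b z = - (flad b z *m parity R x y).
Proof.
move=> nxy hz; rewrite parityE !mono_mul; apply: entP => T S.
rewrite ent_opp !ent_mono; case: ifP => _; last by rewrite oppr0.
rewrite /pz !in_sx1 !signr_addb.
case/orP: hz => /eqP ->; rewrite eqxx ?(negPf nxy) 1?eq_sym ?(negPf nxy) /= ?expr0 ?expr1; ring.
Qed.

Lemma paritysqr x y : parity R x y *m parity R x y = 1%:M.
Proof.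
rewrite parityE mono_mul -mono1; apply: eq_mono => // S.
by rewrite /pz -signr_addb addbb.
Qed.

Lemma mprod_anticomm (gens v : seq Op) A : (forall g, g \in gens -> A *m g = - (g *m A)) ->
  (forall g, g \in v -> g \in gens) -> A *m mprod v = (-1) ^+ size v *: (mprod v *m A).
Proof.
move=> hA; elim: v => [|g v IH] hv /=; first by rewrite mulmx1 mul1mx expr0 scale1r.
rewrite mulmxA hA; last by apply: hv; rewrite inE eqxx.
rewrite mulNmx -(mulmxA g A) IH; last by move=> g' hg'; apply: hv; rewrite inE hg' orbT.
by rewrite -scalemxAr mulmxA exprS mulN1r scaleNr.
Qed.

(* Odd words in the generators anticommute with the parity, so that conjugation
   by the parity kills their contribution to an even operator. *)
Lemma even_comm x y H w b : x != y -> w != x -> w != y -> parity_even x y H ->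
  in_gen_alg [:: cann R x; cann R y; ccre R x; ccre R y] H ->
  H *m flad b w = flad b w *m H.
Proof.
move=> nxy nwx nwy hH [s [hs eH]]; set gens := [:: _; _; _; _] in hs.
have rI : injective (fun z : site L => enum_rank z : nat).
  by move=> u v /val_inj /enum_rank_inj.
have gP g : g \in gens -> exists z c, ((z == x) || (z == y)) /\ g = flad c z.
  rewrite !inE => /or4P[] /eqP ->; rewrite ?cannE ?ccreE.
  - by exists x, false; rewrite eqxx.
  - by exists y, false; rewrite eqxx orbT.
  - by exists x, true; rewrite eqxx.
  - by exists y, true; rewrite eqxx orbT.
have hP g : g \in gens -> parity R x y *m g = - (g *m parity R x y).
  by move=> /gP[z [c [hz ->]]]; apply: parity_ladder.
have hw g : g \in gens -> flad b w *m g = - (g *m flad b w).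
  by move=> /gP[z [c [/orP[]/eqP -> ->]]]; apply: ladder_anticomm.
have e2 : 2%:R *: H = \sum_(v <- s) (v.1 * (1 + (-1) ^+ size v.2)) *: mprod v.2.
  have e : H = parity R x y *m H *m parity R x y.
    by rewrite -hH -mulmxA paritysqr mulmx1.
  rewrite scaler_nat mulr2n {2}e {1 2}eH mulmx_sumr mulmx_suml -big_split.
  apply: eq_big_seq => v hv /=.
  rewrite -scalemxAr -scalemxAl (mprod_anticomm hP (hs v hv)) -scalemxAl -mulmxA paritysqr mulmx1.
  by rewrite scalerA mulrDr mulr1 scalerDl.
(* Only even words survive in [e2], and they commute with a ladder operator of a third mode, each
   letter contributing one sign. *)
have key : 2%:R *: (H *m flad b w) = 2%:R *: (flad b w *m H).
  rewrite scalemxAl scalemxAr e2 mulmx_sumr mulmx_suml; apply: eq_big_seq => v hv /=.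
  rewrite -scalemxAr -scalemxAl (mprod_anticomm hw (hs v hv)) scalerA; congr (_ *: _).
  by rewrite -signr_odd; case: (odd _); rewrite /= ?expr1 ?expr0; ring.
by move/(congr1 (fun M => 2%:R^-1 *: M)): key; rewrite !scalerA mulVf ?pnatr_eq0 // !scale1r.
Qed.

(** The exclusive or makes the notion symmetric: it covers both relative orders of [x] and [y]. *)
Definition between m x y w := [&& w != x, w != y & (m w < m x)%N (+) (m w < m y)%N].

Definition dressing m x y : Op := czop R (fun a w => (a == x) && between m x y w).

Lemma between_irr m x y z : (z == x) && between m x y z = false.
Proof. by rewrite /between; case: eqP. Qed.

Lemma ent_diag_mul (h h' : cfg -> C) A T S :
  ent (mono id h *m A *m mono id h') T S = h T * ent A T S * h' S.
Proof. by rewrite ent_mul_mono ent_mono_mul. Qed.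

(** Invariance under flips outside [X] follows from invariance under single flips, by induction on
    the flipped set. *)
Lemma localopP A (X : pred (site L)) :
  (forall T S z, ent A T S != 0 -> z \in sx T S -> X z) ->
  (forall w T S, ~~ X w -> ent A (sx T [set w]) (sx S [set w]) = ent A T S) ->
  localop A X.
Proof.
move=> h1 h2; split=> // F; move: {2}#|F| (leqnn #|F|) => n.
elim: n F => [|n IH] F hF T S hX.
  by move: hF; rewrite leqn0 cards_eq0 => /eqP ->; rewrite !sx0.
have [->|[w wF]] := set_0Vmem F; first by rewrite !sx0.
have hF' : (#|sx F [set w]| <= n)%N.
  by rewrite -flipqE /flipq wF; move: hF; rewrite (cardsD1 w F) wF add1n ltnS.
have e Z : sx Z F = sx (sx Z (sx F [set w])) [set w] by rewrite -!sxA sxx sx0.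
rewrite !(e _) h2 ?hX // IH // => z; rewrite in_sx1.
by case: (eqVneq z w) => [->|_]; rewrite ?wF // addbF; exact: hX.
Qed.

(** * The dressed image of one pair evolution is a two-site gate *)

Section Gate.
Variables (m : ordering L) (mI : injective m) (x y : site L) (nxy : x != y).
Variables (H : Op) (theta : R).
Hypothesis hermH : is_hermitian H.
Hypothesis evenH : parity_even x y H.
Hypothesis algH : in_gen_alg [:: cann R x; cann R y; ccre R x; ccre R y] H.
Local Notation E := (mexp (Complex 0 (- theta) *: H)).
Local Notation Phi := (JWmat R m).
Let G : Op := Phi *m E *m adj Phi.
Let A : Op := dressing m x y *m G *m dressing m x y.

(** Commutation with [H] passes to its exponential, and conjugation by the isometry carries it to
    the image [N] of [M]. *)
Let comm_conj (M N : Op) : H *m M = M *m H -> Phi *m M = N *m Phi -> G *m N = N *m G.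
Proof.
move=> h1 h2; have [[u1 u2] _] := JWmatP R mI.
have h3 : M *m adj Phi = adj Phi *m N.
  by rewrite -[LHS]mul1mx -u2 -!mulmxA (mulmxA Phi M) h2 -!mulmxA u1 mulmx1.
rewrite /G -!mulmxA -h3 (mulmxA E) (mexp_comm theta hermH h1) -!mulmxA (mulmxA Phi M) h2.
by rewrite -!mulmxA.
Qed.

Let G_ladder w b : w != x -> w != y ->
  G *m ladder R (fun z => m z) b w = ladder R (fun z => m z) b w *m G.
Proof.
move=> h1 h2; apply: (@comm_conj (flad b w)); first exact: (even_comm b nxy h1 h2 evenH algH).
exact: isJW_ladder (JWmatP R mI).
Qed.

Let G_parity : G *m parity R x y = parity R x y *m G.
Proof.
apply: (@comm_conj (parity R x y)); first exact: evenH.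
rewrite parityE /JWmat !mono_mul; apply: eq_mono => // S; exact: mulrC.
Qed.

(** The number operator of [w] is a product of two ladder operators commuting with [G], so [G]
    cannot change the bit at [w]. *)
Let G_diag w T S : w != x -> w != y -> ent G T S != 0 -> (w \in T) = (w \in S).
Proof.
move=> h1 h2 h; have : G *m mono id (fun S => (w \in S)%:R) = mono id (fun S => (w \in S)%:R) *m G.
  rewrite -(ladder_num R (fun z => m z) w) mulmxA (G_ladder true h1 h2).
  by rewrite -mulmxA (G_ladder false h1 h2) mulmxA.
move=> /(congr1 (fun M : Op => ent M T S)); rewrite ent_mul_mono ent_mono_mul // => /eqP.
rewrite mulrC -subr_eq0 -mulrBl mulf_eq0 (negPf h) orbF subr_eq0 => /eqP.
by case: (w \in T); case: (w \in S) => // /eqP; rewrite ?oner_eq0 // eq_sym oner_eq0.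
Qed.

Let G_par T S : ent G T S != 0 -> (x \in T) (+) (y \in T) = (x \in S) (+) (y \in S).
Proof.
move=> h; have /(congr1 (fun M : Op => ent M T S)) := G_parity.
rewrite parityE ent_mul_mono ent_mono_mul // => /eqP.
rewrite mulrC -subr_eq0 -mulrBl mulf_eq0 (negPf h) orbF subr_eq0 /pz => /eqP.
have n1 : (1 : C) != -1 by rewrite -subr_eq0 opprK (_ : 1 + 1 = 2%:R) ?pnatr_eq0.
case: (_ (+) _); case: (_ (+) _) => // /eqP; rewrite ?expr1 ?expr0 ?(negPf n1) //.
by rewrite eq_sym (negPf n1).
Qed.

(** Commutation with the Majorana operator of [w], read entrywise: flipping [w] on both sides
    changes an entry by the ratio of the string signs at [T] and [S]. The dressing has to cancel
    this ratio. *)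
Let G_flip w T S : w != x -> w != y ->
  ent G (sx T [set w]) (sx S [set w]) * chi R (fun z => (m z < m w)%N) S =
  chi R (fun z => (m z < m w)%N) T * ent G T S.
Proof.
move=> h1 h2; have : G *m (ladder R (fun z => m z) false w + ladder R (fun z => m z) true w) =
   (ladder R (fun z => m z) false w + ladder R (fun z => m z) true w) *m G.
  by rewrite mulmxDr mulmxDl !G_ladder.
move=> /(congr1 (fun M : Op => ent M (sx T [set w]) S)).
by rewrite ladder_sum ent_mul_mono ent_mono_mul ?sxK //; exact: sxK.
Qed.

Let entA T S : ent A T S = cz R (fun a w => (a == x) && between m x y w) T * ent G T S *
   cz R (fun a w => (a == x) && between m x y w) S.
Proof. exact: ent_diag_mul. Qed.

Let A_neq0 T S : ent A T S != 0 -> ent G T S != 0.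
Proof. by rewrite entA; apply: contraNneq => ->; rewrite mulr0 mul0r. Qed.

Lemma pair_gate_unitary : unitary A.
Proof.
apply: unitary_mul; last exact: unitary_czop.
apply: unitary_mul; first exact: unitary_czop.
have [u _] := JWmatP R mI.
by apply: unitary_mul; [apply: unitary_mul => //; exact: unitary_mexp | exact: unitary_adj].
Qed.

Lemma pair_gate_parity T S : ent A T S != 0 ->
  (x \in T) (+) (y \in T) = (x \in S) (+) (y \in S).
Proof. by move=> /A_neq0 /G_par. Qed.

Lemma pair_gate_local : localop A (fun z => (z == x) || (z == y)).
Proof.
apply: localopP => [T S z /A_neq0 h|w T S].
  rewrite in_sx; apply: contraTT; rewrite negb_or => /andP[h1 h2].
  by rewrite (G_diag h1 h2 h) addbb.
rewrite negb_or => /andP[nwx nwy]; rewrite !entA.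
have cE Z : cz R (fun a b => (a == x) && between m x y b) (sx Z [set w]) =
    cz R (fun a b => (a == x) && between m x y b) Z * (-1) ^+ ((x \in Z) && between m x y w).
  rewrite cz_sx1; last exact: between_irr.
  congr (_ * _); rewrite (_ : chi R _ Z = chi R (fun z => (z == x) && between m x y w) Z); last first.
    by apply: eq_chi => z; rewrite (negPf nwx).
  rewrite /chi; case hb: (between m x y w); last first.
    by rewrite andbF big_pred0 // => z; rewrite andbF.
  by rewrite andbT (big_pred1 x) // => z; rewrite andbT.
rewrite !cE; have hf := G_flip T S nwx nwy.
set X := chi R _ _ in hf; set Y := chi R _ _ in hf.
have XX : X * X = 1 := chi_sqr R _ _; have YY : Y * Y = 1 := chi_sqr R _ _.
have {hf}-> : ent G (sx T [set w]) (sx S [set w]) = Y * X * ent G T S.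
  by rewrite -[LHS]mulr1 -XX mulrA hf; ring.
have [->|h] := eqVneq (ent G T S) 0; first by rewrite !mulr0 !mul0r.
suff e : (-1) ^+ ((x \in T) && between m x y w) * (-1) ^+ ((x \in S) && between m x y w) * (Y * X) = 1 :> C.
  move: e; set s1 := _ ^+ ((x \in T) && _); set s2 := _ ^+ ((x \in S) && _).
  by clearbody s1 s2 => e; rewrite -[RHS]mul1r -e; ring.
rewrite -signr_addb -andb_addl.
have hz z : z != x -> z != y -> (z \in T) = (z \in S) by move=> h1 h2; apply: G_diag.
have hxy := G_par h.
(* If [x] is not flipped, then by parity neither is [y], so [T] equals [S] and both signs are
   trivial. Otherwise both are flipped, and the string of [w] changes sign precisely when [w] lies
   between them, as does the CZ product. *)
case hx : ((x \in T) (+) (x \in S)); last first.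
  suff -> : Y = X by rewrite XX mulr1.
  rewrite /X /Y; congr (chi R _ _); apply/setP=> z.
  have ex : (x \in T) = (x \in S) by move: hx; case: (x \in T); case: (x \in S).
  have [->//|nzx] := eqVneq z x; have [->|nzy] := eqVneq z y; last exact: hz.
  by move: hxy; rewrite ex => /addbI.
have eT : T = sx (sx S [set x]) [set y].
  apply/setP=> z; rewrite !in_sx1.
  have [->|nzx] := eqVneq z x; first by rewrite (negPf nxy) addbF; move: hx; case: (x \in T); case: (x \in S).
  have [->|nzy] := eqVneq z y; last by rewrite !addbF hz.
  by move: hx hxy; case: (x \in T); case: (x \in S); case: (y \in T); case: (y \in S).
rewrite /Y eT !chi_sx1 -/X andTb.
have -> : between m x y w = (m x < m w)%N (+) (m y < m w)%N.
  have h1 : (m w : nat) != m x by rewrite (inj_eq val_inj) (inj_eq mI).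
  have h2 : (m w : nat) != m y by rewrite (inj_eq val_inj) (inj_eq mI).
  rewrite /between nwx nwy /=.
  by case: (ltngtP (m w) (m x)) h1 => // _ _; case: (ltngtP (m w) (m y)) h2.
rewrite signr_addb; case: (m x < m w)%N; case: (m y < m w)%N; rewrite /= ?expr1 ?expr0; ring: XX.
Qed.

Variables (f : nat -> nat) (t d k : nat).
Hypothesis f_homo : {homo f : a b / (a <= b)%N}.
Local Notation Q := (fun z : site L => f z.1 == t).

Lemma impl_dressing : Q x -> (forall w, between m x y w -> Q w /\ (dist1 x w <= d)%N) ->
  (#|[pred w | between m x y w]| <= k)%N ->
  impl Q (k * (4 ^ d * 2 + 3)) (dressing m x y).
Proof.
move=> hx hb hk; set s := enum [pred w | between m x y w].
have -> : dressing m x y = tprod [seq mono id (fun S => (-1) ^+ ((x \in S) && (w \in S))) | w <- s].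
  have -> : tprod [seq mono id (fun S => (-1) ^+ ((x \in S) && (w \in S))) | w <- s] =
     mono id (fun S => \prod_(w <- s) (-1) ^+ ((x \in S) && (w \in S))).
    elim: s => [|w s IH] /=; first by rewrite -mono1; apply: eq_mono => // S; rewrite big_nil.
    by rewrite IH mono_mul; apply: eq_mono => // S; rewrite big_cons mulrC.
  apply: eq_mono => // S; rewrite /cz /s big_enum /= (bigD1 x) //= [X in _ * X]big1 ?mulr1.
    by apply: eq_bigl => w; rewrite eqxx.
  by move=> a /negPf ha; rewrite big1 // => w; rewrite ha.
apply: (@impl_leq _ _ _ (size s * (4 ^ d * 2 + 3))).
  by rewrite leq_mul2r -cardE hk orbT.
rewrite -(size_map (fun w => mono id (fun S => (-1) ^+ ((x \in S) && (w \in S)))) s).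
apply: impl_tprod => _ /mapP[w hw ->].
move: hw; rewrite mem_enum inE => hw; have [h1 h2] := hb w hw.
by apply: impl_cz => //; rewrite eq_sym; case/and3P: hw.
Qed.

Lemma impl_pair : Q x -> Q y -> (dist1 x y <= d)%N ->
  (forall w, between m x y w -> Q w /\ (dist1 x w <= d)%N) ->
  (#|[pred w | between m x y w]| <= k)%N ->
  impl Q (2 * (k * (4 ^ d * 2 + 3)) + (4 ^ d * 4 + 6)) G.
Proof.
move=> hx hy hd hb hk; have hD := impl_dressing hx hb hk.
have -> : G = dressing m x y *m A *m dressing m x y.
  by rewrite /A /dressing -!mulmxA czopK mulmx1 !mulmxA czopK mul1mx.
apply: (@impl_leq _ _ _ (k * (4 ^ d * 2 + 3) + (4 ^ d * 4 + 6) + k * (4 ^ d * 2 + 3))); first lia.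
apply: impl_mul => //; apply: impl_mul => //.
apply: (impl_two_qubit f_homo hx hy nxy hd pair_gate_unitary pair_gate_local).
exact: pair_gate_parity.
Qed.

End Gate.

End PairGate.

(** * Reordering inside a strip *)

Section StripReordering.
Variables (R : realType) (L : nat).
Local Notation C := R[i].
Local Notation cfg := (cfg L).
Local Notation Op := (Op R L).
Local Notation cn := (@cn R L).
Local Notation mono := (@mono R L).
Implicit Types (S T F : cfg) (A B U V : Op) (x y z w c : site L).

(** No source is the common target, so the sources stay unchanged and the target collects their
    parity. *)
Lemma cn_fanin (s : seq (site L)) (c : site L) : c \notin s ->
  tprod [seq cn a c | a <- s] =
  mono (fun S => if \big[addb/false]_(a <- s) (a \in S) then sx S [set c] else S) (fun=> 1).
Proof.
elim: s => [|a s IH] /=.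
  by move=> _; rewrite -mono1; apply: eq_mono => // S; rewrite big_nil.
rewrite in_cons negb_or => /andP[nca ncs]; rewrite IH // mono_mul; apply: eq_mono => S.
  rewrite big_cons (_ : \big[addb/false]_(b <- s) (b \in cnf a c S) = \big[addb/false]_(b <- s) (b \in S)).
    by rewrite /cnf; case: (a \in S); case: (\big[_/_]_(_ <- _) _); rewrite //= ?sxK.
  apply: eq_big_seq => b hb; rewrite in_cnf (_ : (b == c) = false) ?andbF ?addbF //.
  by apply: contraNF ncs => /eqP <-.
by rewrite mulr1.
Qed.

Variables (f : nat -> nat) (t h r : nat) (bt : pred nat).
Hypothesis f_homo : {homo f : a b / (a <= b)%N}.
Hypothesis f_dist : forall a b, f a = t -> f b = t -> (distn' a b <= h)%N.
Hypothesis f_card : (#|[pred i : 'I_L | f i == t]| <= r)%N.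
Local Notation Q := (fun z : site L => f z.1 == t).
Local Notation bot z := ((f z.1 == t) && bt z.1).
Local Notation top z := ((f z.1 == t) && ~~ bt z.1).

Let bpar (n : nat) S : bool := \big[addb/false]_(y : site L | bot y && (y.2 < n)%N) (y \in S).

Section BottomRow.
Variables (k0 : 'I_L) (fk0 : f k0 = t) (bk0 : bt k0).

(** Row [k0], any row of the bottom half, serves as the accumulator: each of its qubits keeps its
    own bit and adds the parity of the bottom sites in earlier columns. The bound [n] is the last
    column processed. *)
Definition accum n S : cfg :=
  [set z | (z \in S) (+) [&& z.1 == k0, (z.2 <= n)%N & bpar z.2 S]].

Lemma bpar_succ (j : 'I_L) S : bpar j.+1 S =
  bpar j S (+) \big[addb/false]_(k : 'I_L | (f k == t) && bt k) ((k, j) \in S).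
Proof.
rewrite /bpar (bigID (fun y : site L => (y.2 < j)%N)) /=; congr (_ (+) _).
  by apply: eq_bigl => y; rewrite -andbA; congr (_ && _); lia.
transitivity (\big[addb/false]_(k : 'I_L | (f k == t) && bt k) \big[addb/false]_(l : 'I_L | l == j) ((k, l) \in S)).
  rewrite (pair_big (fun k : 'I_L => (f k == t) && bt k) (fun l => l == j) (fun k l => (k, l) \in S)) /=.
  apply: eq_big => [y|[a b] _ //]; rewrite -andbA; congr (_ && _).
  by rewrite -(inj_eq val_inj) /=; lia.
by apply: eq_bigr => k _; rewrite big_pred1_eq.
Qed.

(** The accumulator in column [j] already contains the parity of all earlier columns, so the bottom
    sites of this single column sum to what column [j'] must receive. *)
Lemma accum_succ (j j' : 'I_L) S : (j' : nat) = j.+1 ->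
  (if \big[addb/false]_(a <- [seq (k, j) | k <- enum [pred k : 'I_L | (f k == t) && bt k]]) (a \in accum j S)
   then sx (accum j S) [set (k0, j')] else accum j S) = accum j' S.
Proof.
move=> ej; have -> : \big[addb/false]_(a <- [seq (k, j) | k <- enum [pred k : 'I_L | (f k == t) && bt k]]) (a \in accum j S) = bpar j' S.
  rewrite big_map big_enum /= ej bpar_succ.
  rewrite (eq_bigr (fun k => ((k, j) \in S) (+) ((k == k0) && bpar j S))); last first.
    by move=> k _; rewrite inE /= leqnn.
  rewrite big_split /= addbC; congr (_ (+) _).
  rewrite (bigD1 k0) /=; last by rewrite inE fk0 eqxx bk0.
  by rewrite eqxx big1 ?addbF // => k /andP[_ /negPf ->].
apply/setP=> z; rewrite (_ : (z \in if bpar j' S then sx (accum j S) [set (k0, j')] else accum j S) =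
   (z \in accum j S) (+) (bpar j' S && (z == (k0, j')))); last first.
  by case: (bpar j' S); rewrite ?in_sx1 ?addbF.
rewrite !inE -addbA; congr (_ (+) _).
case: z => a b; rewrite -pair_eqE /=; case: (a == k0); rewrite ?andbF //=.
have [->|nb] := eqVneq b j'; first by rewrite ej ltnn leqnn andbT.
rewrite andbF addbF; congr (_ && _); move: nb; rewrite -(inj_eq val_inj) /=; lia.
Qed.

(** Each new column takes at most [r] CNOTs, each spanning at most [h] rows and one column, hence
    the exponent [h.+1]. *)
Lemma impl_accum n : (n < L)%N -> impl Q (n * (r * 4 ^ h.+1)) (mono (accum n) (fun=> 1)).
Proof.
elim: n => [|n IH] hn.
  rewrite (_ : mono _ _ = 1%:M); first exact: impl1.
  rewrite -mono1; apply: eq_mono => // S; apply/setP=> z; rewrite !inE.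
  case: z => a b /=; rewrite leqn0; case: (eqVneq (b : nat) 0%N) => [e|]; last by rewrite andbF addbF.
  by rewrite /bpar big_pred0 ?andbF ?addbF // => y; rewrite e ltn0 andbF.
pose j := Ordinal (ltnW hn); pose j' := Ordinal hn.
set bots := enum [pred k : 'I_L | (f k == t) && bt k].
have hfan := @cn_fanin [seq (k, j) | k <- bots] (k0, j').
have nin : (k0, j') \notin [seq (k, j) | k <- bots].
  by apply/mapP => -[k _ [_ e]]; lia.
have -> : mono (accum n.+1) (fun=> 1) =
   tprod [seq cn a (k0, j') | a <- [seq (k, j) | k <- bots]] *m mono (accum n) (fun=> 1).
  rewrite hfan // mono_mul; apply: eq_mono => S; last by rewrite mulr1.
  by rewrite -(@accum_succ j j').
rewrite mulSn; apply: impl_mul; last by apply: IH; lia.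
apply: (@impl_leq _ _ _ (size bots * 4 ^ h.+1)).
  rewrite leq_mul2r; apply/orP; right; rewrite -cardE.
  by apply: leq_trans f_card; apply: subset_leq_card; apply/fintype.subsetP=> k; rewrite !inE => /andP[].
have -> : size bots = size [seq cn a (k0, j') | a <- [seq (k, j) | k <- bots]] by rewrite !size_map.
apply: impl_tprod => _ /mapP[_ /mapP[k hk ->] ->].
move: hk; rewrite mem_enum inE => /andP[/eqP fk bk].
apply: impl_cn => //=; rewrite ?fk ?fk0 //.
  by rewrite -pair_eqE /= negb_and; apply/orP; right; rewrite -(inj_eq val_inj) /=; lia.
rewrite /dist1 /= (_ : distn' n n.+1 = 1%N) ?addn1 ?ltnS; first exact: f_dist.
by rewrite /distn'; lia.
Qed.

Let phaseF S : C := \prod_(x : site L | top x) (-1) ^+ ((x \in S) && ((k0, x.2) \in S)).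

Lemma impl_phaseF : impl Q (r * L * (4 ^ h.+1 * 2 + 3)) (mono id phaseF).
Proof.
set s := enum [pred x : site L | top x].
have -> : mono id phaseF = tprod [seq mono id (fun S => (-1) ^+ ((x \in S) && ((k0, x.2) \in S))) | x <- s].
  have -> : tprod [seq mono id (fun S => (-1) ^+ ((x \in S) && ((k0, x.2) \in S))) | x <- s] =
     mono id (fun S => \prod_(x <- s) (-1) ^+ ((x \in S) && ((k0, x.2) \in S))).
    elim: s => [|w s IH] /=; first by rewrite -mono1; apply: eq_mono => // S; rewrite big_nil.
    by rewrite IH mono_mul; apply: eq_mono => // S; rewrite big_cons mulrC.
  by apply: eq_mono => // S; rewrite /phaseF /s big_enum.
apply: (@impl_leq _ _ _ (size s * (4 ^ h.+1 * 2 + 3))).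
  rewrite leq_mul2r; apply/orP; right; rewrite -cardE.
  have := cardX [pred i : 'I_L | f i == t] [pred j : 'I_L | true].
  rewrite -[#|[pred j : 'I_L | true]|]/(#|'I_L|) card_ord => e.
  apply: (@leq_trans (#|[pred i : 'I_L | f i == t]| * L)); last by rewrite leq_mul2r f_card orbT.
  rewrite -e; apply: subset_leq_card; apply/fintype.subsetP=> -[a b]; rewrite !inE /= => /andP[-> _] //.
rewrite -(size_map (fun x => mono id (fun S => (-1) ^+ ((x \in S) && ((k0, x.2) \in S)))) s).
apply: impl_tprod => _ /mapP[x hx ->].
move: hx; rewrite mem_enum inE => /andP[/eqP fx bx].
apply: impl_cz => //=; rewrite ?fx ?fk0 //.
  by apply: contraNneq bx => ->.
by rewrite /dist1 /= distnn' addn0; apply: leq_trans (f_dist fx fk0) _.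
Qed.

Lemma impl_reorder_bottom :
  impl Q (L * (r * (4 ^ h.+1 * 6 + 6))) (czop R (fun x y => [&& top x, bot y & (y.2 < x.2)%N])).
Proof.
have hL : (L.-1 < L)%N by have := ltn_ord k0; lia.
set Acc := mono (accum L.-1) (fun=> 1).
have hAcc : impl Q (L.-1 * (r * 4 ^ h.+1)) Acc by apply: impl_accum.
have [_ uA] := impl_unitary hAcc.
have eA : adj Acc *m mono id phaseF *m Acc = mono id (fun S => phaseF (accum L.-1 S)).
  rewrite -mulmxA (_ : mono id phaseF *m Acc = Acc *m mono id (fun S => phaseF (accum L.-1 S))).
    by rewrite mulmxA uA mul1mx.
  by rewrite !mono_mul; apply: eq_mono => // S; rewrite mulrC.
(* The accumulator also holds its own bit, which would add a CZ within the column. A second,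
   unaccumulated round of [phaseF] cancels it and leaves strictly earlier columns only. *)
have -> : czop R (fun x y => [&& top x, bot y & (y.2 < x.2)%N]) =
    mono id phaseF *m (adj Acc *m mono id phaseF *m Acc).
  rewrite eA mono_mul; apply: eq_mono => // S; rewrite /cz /phaseF -big_split /=.
  rewrite [LHS](bigID (fun x : site L => top x)) /= [X in _ * X]big1 ?mulr1; last first.
    by move=> x /negPf hx; rewrite big_pred0 // => y; rewrite hx.
  apply: eq_bigr => x hx; rewrite -signr_addb.
  have xA : (x \in accum L.-1 S) = (x \in S).
    rewrite inE (_ : (x.1 == k0) = false) ?addbF //.
    by apply/eqP=> e; move: hx; rewrite e bk0 andbF.
  have kA : ((k0, x.2) \in accum L.-1 S) = ((k0, x.2) \in S) (+) bpar x.2 S.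
    rewrite inE /= eqxx (_ : (x.2 <= L.-1)%N) //; have := ltn_ord x.2; lia.
  rewrite xA kA -andb_addr addbA addbb addFb /bpar.
  rewrite (eq_bigl (fun y : site L => bot y && (y.2 < x.2)%N)); last by move=> y; rewrite hx.
  rewrite (_ : (x \in S) && \big[addb/false]_(y : site L | bot y && (y.2 < x.2)%N) (y \in S) =
     \big[addb/false]_(y : site L | bot y && (y.2 < x.2)%N) ((x \in S) && (y \in S))); last first.
    by rewrite big_distrr.
  by symmetry; apply: (big_morph (fun b : bool => (-1) ^+ b : C)) => // a b; rewrite signr_addb.
apply: (@impl_leq _ _ _ (r * L * (4 ^ h.+1 * 2 + 3) + (L.-1 * (r * 4 ^ h.+1) + r * L * (4 ^ h.+1 * 2 + 3) + L.-1 * (r * 4 ^ h.+1)))).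
  have : (L.-1 * (r * 4 ^ h.+1) <= L * (r * 4 ^ h.+1))%N by rewrite leq_mul2r leq_pred orbT.
  by rewrite !mulnDr; set u := (4 ^ h.+1)%N; rewrite !mulnA; nia.
have hF := impl_phaseF.
by apply: impl_mul => //; apply: impl_mul => //; apply: impl_mul => //; exact: impl_adj.
Qed.

End BottomRow.

Lemma impl_reorder :
  impl Q (L * (r * (4 ^ h.+1 * 6 + 6))) (czop R (fun x y => [&& top x, bot y & (y.2 < x.2)%N])).
Proof.
case: (pickP [pred k : 'I_L | (f k == t) && bt k]) => [k /andP[/eqP fk bk]|hno].
  exact: impl_reorder_bottom fk bk.
(* A strip cut off by the edge of the lattice may have no bottom row; no pair is then inverted. *)
rewrite (_ : czop _ _ = 1%:M); first exact: (impl_leq _ (impl1 _ _)).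
rewrite -mono1; apply: eq_mono => // S; rewrite /cz big1 // => x _.
by rewrite big_pred0 // => y; have := hno y.1; rewrite /= => ->; rewrite andbF.
Qed.

End StripReordering.

(** * Orderings and strips *)

Section Orderings.
Variable L : nat.
Implicit Types (x y z w : site L).

Lemma ord_of_key_subproof (key : site L -> nat) x :
  (#|[pred y | (key y < key x)%N]| < L * L)%N.
Proof.
have -> : (L * L)%N = #|{: site L}| by rewrite card_prod card_ord.
apply: proper_card; apply/properP; split; first by apply/fintype.subsetP.
by exists x; rewrite // inE ltnn.
Qed.

(** The rank of a site among the keys, so that an injective key with large values becomes a
    bijection onto the positions. *)
Definition ord_of_key (key : site L -> nat) : ordering L :=
  fun x => Ordinal (ord_of_key_subproof key x).

Lemma ord_of_key_lt key x y : (ord_of_key key y < ord_of_key key x)%N = (key y < key x)%N.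
Proof.
apply/idP/idP => /= h.
  rewrite ltnNge; apply: contraL h => hxy; rewrite -leqNgt.
  apply: subset_leq_card; apply/fintype.subsetP=> z; rewrite !inE => hz.
  exact: leq_trans hxy.
apply: proper_card; apply/properP; split.
  by apply/fintype.subsetP=> z; rewrite !inE => hz; apply: ltn_trans h.
by exists y; rewrite !inE ?ltnn.
Qed.

Lemma ord_of_key_bij key : injective key -> bijective (ord_of_key key).
Proof.
move=> kI; apply: inj_card_bij; last by rewrite card_prod !card_ord.
move=> x y e; apply: kI; apply/eqP; have := ord_of_key_lt key x y.
by have := ord_of_key_lt key y x; rewrite e ltnn; case: ltngtP.
Qed.

(** Base [L] encoding of the lexicographic order by strip, then column, then row. *)
Definition strip_key (s : nat -> nat) x : nat := ((s x.1 * L + x.2) * L + x.1)%N.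

Lemma ltn_lex (a b a' b' : nat) : (b < L)%N -> (b' < L)%N ->
  (a * L + b < a' * L + b')%N = (a < a')%N || (a == a') && (b < b')%N.
Proof.
move=> hb hb'; case: (ltngtP a a') => /= h; last by rewrite h ltn_add2l.
- by have : (a.+1 * L <= a' * L)%N; [rewrite leq_mul2r h orbT | rewrite mulSn; lia].
- by have : (a'.+1 * L <= a * L)%N; [rewrite leq_mul2r h orbT | rewrite mulSn; lia].
Qed.

Lemma strip_key_lt s x y : (strip_key s y < strip_key s x)%N =
  (s y.1 < s x.1)%N || (s y.1 == s x.1) &&
    ((y.2 < x.2)%N || (y.2 == x.2) && (y.1 < x.1)%N).
Proof.
rewrite /strip_key !ltn_lex ?ltn_ord //.
have -> : (s y.1 * L + y.2 == s x.1 * L + x.2)%N = (s y.1 == s x.1) && (y.2 == x.2).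
  apply/eqP/andP => [e|[/eqP -> /eqP ->] //].
  have h1 := ltn_lex (s y.1) (s x.1) (ltn_ord y.2) (ltn_ord x.2).
  have h2 := ltn_lex (s x.1) (s y.1) (ltn_ord x.2) (ltn_ord y.2).
  move: h1 h2; rewrite e ltnn -(inj_eq val_inj) /=.
  by case: ltngtP => //= _; case: ltngtP.
by case: ltngtP => //= _; case: ltngtP.
Qed.

Lemma strip_key_inj s : injective (strip_key s).
Proof.
move=> [a b] [c d] e.
have h1 := strip_key_lt s (a, b) (c, d); have h2 := strip_key_lt s (c, d) (a, b).
move: h1 h2; rewrite e ltnn /= => h1 h2.
have hb : b = d.
  apply/eqP; rewrite -(inj_eq val_inj) /=; move: h1 h2.
  by case: (ltngtP (s a)) => //= _; case: (ltngtP b d).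
have ha : a = c.
  apply/eqP; rewrite -(inj_eq val_inj) /=; move: h1 h2; rewrite hb eqxx ltnn /=.
  by case: (ltngtP (s a)) => //= _; case: (ltngtP a c).
by rewrite ha hb.
Qed.

End Orderings.

(** * The two families of strips, their half-strips and counting bounds *)

Section Strips.
Variables (delta L : nat).
Hypothesis delta_gt0 : (0 < delta)%N.
Implicit Types (x y z w : site L) (a : bool) (i j : nat).

Definition hstrip a i : nat := ((i + a * delta) %/ delta)%N.
Definition strip a i : nat := (hstrip a i)./2.

Lemma stripE a i : strip a i = ((i + a * delta) %/ (delta * 2))%N.
Proof. by rewrite /strip /hstrip -divn2 divnMA. Qed.

(** The shift by [delta] merely renumbers the half-strips, so both families induce the same order of
    half-strips; only their grouping in twos differs. *)
Lemma halfE a i : hstrip a i = (i %/ delta + a)%N.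
Proof. by rewrite /hstrip addnC divnMDl // addnC. Qed.

Lemma half_homo a : {homo hstrip a : i j / (i <= j)%N}.
Proof. by move=> i j h; rewrite /hstrip leq_div2r // leq_add2r. Qed.

Lemma strip_homo a : {homo strip a : i j / (i <= j)%N}.
Proof. by move=> i j h; rewrite /strip half_leq // half_homo. Qed.

Lemma strip_bounds a i t : strip a i = t ->
  (t * (delta * 2) <= i + a * delta < t * (delta * 2) + delta * 2)%N.
Proof.
rewrite stripE => <-; rewrite leq_trunc_div /= [X in (_ < X)%N]addnC -mulSn ltn_ceil //; lia.
Qed.

Lemma strip_dist a t i j : strip a i = t -> strip a j = t -> (distn' i j <= delta * 2)%N.
Proof. by move=> /strip_bounds hi /strip_bounds hj; rewrite /distn'; lia. Qed.

Lemma strip_lt a (i : 'I_L) : (strip a i < L)%N.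
Proof. rewrite stripE ltn_divLR; last lia; have := ltn_ord i; case: a => /=; nia. Qed.

Lemma card_strip a t : (#|[pred i : 'I_L | strip a i == t]| <= delta * 2)%N.
Proof.
have hD : (0 < delta * 2)%N by lia.
pose g (i : 'I_L) : 'I_(delta * 2) := Ordinal (ltn_pmod (i + a * delta) hD).
rewrite -(card_in_image (f := g)); last first.
  move=> i j; rewrite !inE !stripE => /eqP hi /eqP hj [e].
  apply: val_inj => /=; have := divn_eq (i + a * delta) (delta * 2).
  by rewrite e hi -hj -divn_eq; lia.
by apply: leq_trans (max_card _) _; rewrite card_ord.
Qed.

Lemma card_near j : (#|[pred l : 'I_L | (distn' l j <= delta)%N]| <= (delta * 2).+1)%N.
Proof.
pose g (l : 'I_L) : 'I_(delta * 2).+1 := inord (l + delta - j).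
rewrite -(card_in_image (f := g)); last first.
  move=> k l; rewrite !inE /distn' => hk hl /(congr1 val) /=.
  by rewrite !inordK; [move=> e; apply: val_inj => /=; lia | lia | lia].
by apply: leq_trans (max_card _) _; rewrite card_ord.
Qed.

Lemma card_strip_near a t j :
  (#|[pred w : site L | (strip a w.1 == t) && (distn' w.2 j <= delta)%N]|
     <= delta * 2 * (delta * 2).+1)%N.
Proof.
apply: leq_trans (leq_mul (card_strip a t) (card_near j)); rewrite -cardX.
by apply: subset_leq_card; apply/fintype.subsetP=> -[k l]; rewrite !inE.
Qed.

Lemma card_near_pairs :
  (#|[pred u : 'I_L * 'I_L | (distn' u.1 u.2 <= delta)%N]| <= L * (delta * 2).+1)%N.
Proof.
pose g (u : 'I_L * 'I_L) : 'I_L * 'I_(delta * 2).+1 := (u.1, inord (u.2 + delta - u.1)).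
rewrite -(card_in_image (f := g)); last first.
  move=> [k l] [k' l']; rewrite !inE /distn' /= => hk hl [ek] /(congr1 val) /=.
  rewrite ek in hk *; rewrite !inordK; [move=> e | lia | lia].
  by congr pair; apply: val_inj => /=; lia.
by apply: leq_trans (max_card _) _; rewrite card_prod !card_ord.
Qed.

(** For a pair inside one strip the maximum is the index of that strip; being defined for every set,
    it can be used to sort the pairs. *)
Definition strip_index a (e : {set site L}) : nat := \max_(z in e) strip a z.1.

Definition in_strip a t (e : {set site L}) : bool := [forall z in e, strip a z.1 == t].

Lemma in_stripP a t x y : in_strip a t [set x; y] = (strip a x.1 == t) && (strip a y.1 == t).
Proof.
apply/forall_inP/andP => [h|[hx hy] z]; first by split; apply: h; rewrite !inE eqxx ?orbT.
by rewrite !inE => /orP[]/eqP ->.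
Qed.

Lemma strip_index2 a x y : strip_index a [set x; y] = maxn (strip a x.1) (strip a y.1).
Proof.
apply/eqP; rewrite eqn_leq geq_max; apply/andP; split.
  by apply/bigmax_leqP => z; rewrite !inE => /orP[]/eqP ->; rewrite ?leq_maxl ?leq_maxr.
by apply/andP; split; apply: (leq_bigmax_cond (F := fun z : site L => strip a z.1));
  rewrite !inE eqxx ?orbT.
Qed.

Lemma strip_index_lt a x y : (strip_index a [set x; y] < L)%N.
Proof. by rewrite strip_index2 gtn_max !strip_lt. Qed.

Lemma PsetP e : e \in Pset L delta ->
  exists x y, [/\ x != y, (dinf x y <= delta)%N & e = [set x; y]].
Proof.
by rewrite inE => /existsP[x /existsP[y /and3P[h1 h2 /eqP h3]]]; exists x, y.
Qed.

(** A pair split by a boundary of the unshifted family has both rows within [delta] of it, and that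
    boundary is the middle of a shifted strip. *)
Lemma strip_cover x y : (dinf x y <= delta)%N ->
  ~~ in_strip false (strip_index false [set x; y]) [set x; y] ->
  in_strip true (strip_index true [set x; y]) [set x; y].
Proof.
rewrite /dinf geq_max => /andP[hd _]; rewrite !in_stripP !strip_index2 => h0.
suff -> : strip true x.1 = strip true y.1 by rewrite maxnn eqxx.
have [bx by0] := (strip_bounds (erefl (strip false x.1)), strip_bounds (erefl (strip false y.1))).
have [cx cy] := (strip_bounds (erefl (strip true x.1)), strip_bounds (erefl (strip true y.1))).
have ne : strip false x.1 != strip false y.1.
  by apply: contra h0 => /eqP ->; rewrite maxnn eqxx.
move: bx by0 cx cy ne hd; rewrite /distn' mul0n mul1n !addn0.
move: (strip false x.1) (strip false y.1) (strip true x.1) (strip true y.1) => u v u' v'.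
move: (nat_of_ord x.1) (nat_of_ord y.1) => p q bx by0 cx cy ne hd.
have lt_of b b' c c' : (b * (delta * 2) <= c)%N -> (c' < b' * (delta * 2) + delta * 2)%N -> (c <= c')%N -> (b <= b')%N.
  move=> h1 h2 h3; rewrite leqNgt; apply/negP=> hb.
  have : (b'.+1 * (delta * 2) <= b * (delta * 2))%N by rewrite leq_mul2r hb orbT.
  by rewrite mulSn; lia.
have [huv|huv] : (u < v)%N \/ (v < u)%N by lia.
  have h1 : (u.+1 * (delta * 2) <= v * (delta * 2))%N by rewrite leq_mul2r huv orbT.
  rewrite mulSn in h1; apply/eqP; rewrite eqn_leq; apply/andP; split.
    by apply: (lt_of _ _ (p + delta) (q + delta))%N; lia.
  apply: (@leq_trans u.+1); first by apply: (lt_of _ _ (q + delta) (q + delta))%N; rewrite ?mulSn; lia.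
  by apply: (lt_of _ _ (p + delta) (p + delta))%N; rewrite ?mulSn; lia.
have h1 : (v.+1 * (delta * 2) <= u * (delta * 2))%N by rewrite leq_mul2r huv orbT.
rewrite mulSn in h1; apply/eqP; rewrite eqn_leq; apply/andP; split.
  apply: (@leq_trans v.+1); first by apply: (lt_of _ _ (p + delta) (p + delta))%N; rewrite ?mulSn; lia.
  by apply: (lt_of _ _ (q + delta) (q + delta))%N; rewrite ?mulSn; lia.
by apply: (lt_of _ _ (q + delta) (p + delta))%N; lia.
Qed.

(** A pair is determined by two rows of the strip and two columns at distance at most [delta], which
    gives a bound linear in [L]. *)
Lemma size_strip_pairs a t (s : seq {set site L}) : uniq s ->
  (forall e, e \in s -> e \in Pset L delta /\ in_strip a t e) ->
  (size s <= delta * 2 * (delta * 2) * (delta * 2).+1 * L)%N.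
Proof.
move=> us hs.
pose A : pred (('I_L * 'I_L) * ('I_L * 'I_L)) :=
  [predX [predX [pred i : 'I_L | strip a i == t] & [pred i : 'I_L | strip a i == t]]
       & [pred u : 'I_L * 'I_L | (distn' u.1 u.2 <= delta)%N]].
pose g (u : ('I_L * 'I_L) * ('I_L * 'I_L)) : {set site L} :=
  [set (u.1.1, u.2.1); (u.1.2, u.2.2)].
apply: (@leq_trans (size [seq g u | u in A])).
  apply: uniq_leq_size => // e /hs [/PsetP[[x1 x2] [[y1 y2] [_ hd ->]]]].
  rewrite in_stripP /= => /andP[hx hy].
  apply/fintype.imageP; exists ((x1, y1), (x2, y2)) => //.
  rewrite !inE /= hx hy /=; apply: leq_trans hd; exact: leq_maxr.
rewrite fintype.size_image /A !cardX -[X in (_ <= X)%N]mulnA [(_.+1 * L)%N]mulnC.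
apply: leq_mul; first by apply: leq_mul; exact: card_strip.
exact: card_near_pairs.
Qed.

(** * Inversions between the strip orders and the half-strip order *)

Definition strip_order a : ordering L := ord_of_key (strip_key (strip a)).
Definition half_order : ordering L := ord_of_key (strip_key (hstrip false)).

(** Even half-strips are the top halves. The column comparison is strict because within one column
    both orders put the top site first. *)
Definition reorder_rel a x y : bool :=
  [&& strip a x.1 == strip a y.1, ~~ odd (hstrip a x.1), odd (hstrip a y.1) & (y.2 < x.2)%N].

Lemma reorder_irr a z : reorder_rel a z z = false.
Proof. by rewrite /reorder_rel ltnn !andbF. Qed.

(** Sites of different strips compare alike in both orders, as do sites of the same half-strip.
    There remain a top and a bottom site of one strip: the half-strip order puts the top one first,
    the strip order looks at the columns. *)
Lemma half_order_lt a x y : (half_order y < half_order x)%N =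
  (strip_order a y < strip_order a x)%N (+) (reorder_rel a x y (+) reorder_rel a y x).
Proof.
rewrite !ord_of_key_lt !strip_key_lt /reorder_rel.
have -> : (hstrip false y.1 < hstrip false x.1)%N = (hstrip a y.1 < hstrip a x.1)%N.
  by rewrite !halfE addn0 addn0 ltn_add2r.
have -> : (hstrip false y.1 == hstrip false x.1) = (hstrip a y.1 == hstrip a x.1).
  by rewrite !halfE addn0 addn0 eqn_add2r.
have hxy : (hstrip a y.1 < hstrip a x.1)%N -> (y.1 < x.1)%N.
  by rewrite !ltnNge; apply: contra => /(half_homo a).
have hyx : (hstrip a x.1 < hstrip a y.1)%N -> (x.1 < y.1)%N.
  by rewrite !ltnNge; apply: contra => /(half_homo a).
rewrite /strip -(inj_eq val_inj y.2) /=.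
move: (hstrip a y.1) (hstrip a x.1) hxy hyx => q p hxy hyx.
have eq := odd_double_half q; have ep := odd_double_half p.
case: (ltngtP q./2 p./2) => hh /=; rewrite ?addbF ?addFb.
- have -> : (q < p)%N by case: (odd q) eq; case: (odd p) ep => /=; lia.
  by [].
- have -> : (q < p)%N = false by case: (odd q) eq; case: (odd p) ep => /=; lia.
  by have -> : (q == p) = false by case: (odd q) eq; case: (odd p) ep => /=; lia.
have hlt : (q < p)%N = ~~ odd q && odd p.
  by case: (odd q) eq; case: (odd p) ep => /=; lia.
have hgt : (p < q)%N = odd q && ~~ odd p.
  by case: (odd q) eq; case: (odd p) ep => /=; lia.
have heq : (q == p) = (odd q == odd p).
  by case: (odd q) eq; case: (odd p) ep => /=; lia.
move: hxy hyx; rewrite hlt hgt heq; case: (odd q); case: (odd p) => //=; rewrite ?addbF //.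
  by move=> _ /(_ isT) h; rewrite (ltnNge y.1) (ltnW h) andbF orbF addbb.
by move=> /(_ isT) -> _; rewrite andbT; case: (ltngtP (y.2 : nat) x.2).
Qed.

Lemma strip_order_lt a x y : (strip_order a y < strip_order a x)%N =
  (half_order y < half_order x)%N (+) (reorder_rel a x y (+) reorder_rel a y x).
Proof. by rewrite (half_order_lt a) -addbA addbb addbF. Qed.

(** The strip order goes column by column, so a mode in between lies in the same strip and in a
    column between those of [x] and [y], ends included. *)
Lemma between_strip a t x y w : strip a x.1 = t -> strip a y.1 = t -> (dinf x y <= delta)%N ->
  between (strip_order a) x y w ->
  (strip a w.1 == t) && (distn' w.2 x.2 <= delta)%N.
Proof.
move=> hx hy; rewrite /dinf geq_max => /andP[_ hd] /and3P[_ _].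
rewrite !ord_of_key_lt !strip_key_lt hx hy.
move: hd; rewrite /distn' -!(inj_eq val_inj w.2) /=.
case: (ltngtP (strip a w.1) t) => //= _.
by case: (ltngtP w.2 x.2); case: (ltngtP w.2 y.2) => /=; lia.
Qed.

End Strips.

(** * The circuit *)

Lemma perm_flatten_filter (T : eqType) (s : seq T) (p : pred T) (g : T -> nat) (n : nat) :
  perm_eq (flatten [seq [seq e <- s | p e && (g e == t)] | t <- iota 0 n])
          [seq e <- s | p e && (g e < n)%N].
Proof.
elim: n => [|n IH].
  by rewrite /= (eq_filter (a2 := pred0)) ?filter_pred0 // => e /=; rewrite andbF.
rewrite -addn1 iotaD map_cat flatten_cat /= cats0 add0n addn1.
set s' := [seq e <- s | p e && (g e < n.+1)%N].
have e1 : [seq e <- s | p e && (g e < n)%N] = [seq e <- s' | (g e < n)%N].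
  rewrite -filter_predI; apply: eq_filter => e /=; case: (p e); rewrite ?andbF //=.
  by apply/idP/andP => [h|[]//]; split=> //; lia.
have e2 : [seq e <- s | p e && (g e == n)] = [seq e <- s' | ~~ (g e < n)%N].
  rewrite -filter_predI; apply: eq_filter => e /=; case: (p e); rewrite ?andbF //=; lia.
rewrite e2 (perm_trans (y := [seq e <- s' | (g e < n)%N] ++ [seq e <- s' | ~~ (g e < n)%N])) //.
  by rewrite perm_cat2r -e1.
exact/permPl/perm_filterC.
Qed.

Section Assembly.
Variables (R : realType) (L : nat).
Local Notation C := R[i].
Local Notation Op := (Op R L).
Local Notation circuit := (circuit R L).
Implicit Types (x y z w : site L) (A B U V : Op).

Lemma tprod_flatten (ss : seq (seq Op)) : tprod (flatten ss) = tprod (map (@tprod R L) ss).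
Proof. by elim: ss => //= s ss IH; rewrite tprod_cat IH. Qed.

Lemma tprod_conj A (s : seq Op) : unitary A ->
  tprod [seq A *m B *m adj A | B <- s] = A *m tprod s *m adj A.
Proof.
move=> [u1 u2]; elim: s => [|B s IH] /=; first by rewrite mulmx1 u1.
by rewrite IH -!mulmxA (mulmxA (adj A) A) u2 mul1mx.
Qed.

Lemma evolE (H : {set site L} -> Op) (theta : {set site L} -> R) (ps : seq {set site L}) :
  evol H theta ps = tprod [seq mexp (Complex 0 (- theta e) *: H e) | e <- ps].
Proof. by rewrite /evol /tprod foldr_map. Qed.

Lemma circuit_ok_cat (c1 c2 : circuit) : circuit_ok c1 -> circuit_ok c2 -> circuit_ok (c1 ++ c2).
Proof. by elim: c1 => //= l c1 IH [hl h1] h2; split=> //; apply: IH. Qed.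

Lemma gate_count_cat (c1 c2 : circuit) : gate_count (c1 ++ c2) = (gate_count c1 + gate_count c2)%N.
Proof. by rewrite /gate_count map_cat sumn_cat. Qed.

Lemma circ_op_cat (c1 c2 : circuit) : circ_op (c1 ++ c2) = circ_op c2 *m circ_op c1.
Proof. by rewrite !circ_opE map_cat tprod_cat. Qed.

Lemma czop_split (E : rel (site L)) (g : site L -> nat) n : (forall x, (g x < n)%N) ->
  czop R E = tprod [seq czop R (fun x y => E x y && (g x == t)) | t <- iota 0 n].
Proof.
move=> hg.
have -> : tprod [seq czop R (fun x y => E x y && (g x == t)) | t <- iota 0 n] =
    @mono R L id (fun S => \prod_(t <- iota 0 n) cz R (fun x y => E x y && (g x == t)) S).
  elim: (iota 0 n) => [|t s IH] /=; first by rewrite -mono1; apply: eq_mono => // S; rewrite big_nil.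
  by rewrite IH mono_mul; apply: eq_mono => // S; rewrite big_cons mulrC.
apply: eq_mono => // S; rewrite /cz exchange_big; apply: eq_bigr => x _ /=.
rewrite (bigD1_seq (g x)) ?iota_uniq ?mem_iota ?hg //= [X in _ * X]big1 ?mulr1.
  by apply: eq_bigl => y; rewrite eqxx andbT.
by move=> t /negPf ht; rewrite big_pred0 // => y; rewrite eq_sym ht andbF.
Qed.

Variable delta : nat.
Hypothesis delta_gt0 : (0 < delta)%N.

(** The factor [delta * 2 * (delta * 2).+1] bounds the modes in between, by rows of the strip times
    nearby columns; [delta * 3] bounds the distances, [delta * 2] vertically and [delta]
    horizontally. *)
Definition pair_cost : nat :=
  (2 * (delta * 2 * (delta * 2).+1 * (4 ^ (delta * 3) * 2 + 3)) + (4 ^ (delta * 3) * 4 + 6))%N.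
Definition pairs_cost : nat := (delta * 2 * (delta * 2) * (delta * 2).+1 * pair_cost)%N.
Definition reorder_cost : nat := (delta * 2 * (4 ^ (delta * 2).+1 * 6 + 6))%N.

Variables (H : {set site L} -> Op) (theta : {set site L} -> R).
Hypothesis hH : forall x y : site L, x != y -> (dinf x y <= delta)%N ->
       is_hermitian (H [set x; y]) /\ parity_even x y (H [set x; y]) /\
       in_gen_alg [:: cann R x; cann R y; ccre R x; ccre R y] (H [set x; y]).
Local Notation ev e := (mexp (Complex 0 (- theta e) *: H e)).
Local Notation order := (@strip_order delta L).

Lemma strip_order_inj a : injective (order a).
Proof. exact/bij_inj/ord_of_key_bij/strip_key_inj. Qed.

Lemma impl_strip_pair a t e : e \in Pset L delta -> in_strip delta a t e ->
  impl (fun z => strip delta a z.1 == t) pair_cost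
    (JWmat R (order a) *m ev e *m adj (JWmat R (order a))).
Proof.
move=> /PsetP[x [y [nxy hd ->]]]; rewrite in_stripP => /andP[/eqP hx /eqP hy].
have [h1 [h2 h3]] := hH nxy hd.
have hdist z : strip delta a z.1 == t -> (distn' z.2 x.2 <= delta)%N -> (dist1 x z <= delta * 3)%N.
  move=> /eqP hz hc; have := strip_dist delta_gt0 hx hz; move: hc.
  by rewrite /dist1 /distn'; lia.
have hb w : between (order a) x y w -> strip delta a w.1 == t /\ (dist1 x w <= delta * 3)%N.
  by move=> /(between_strip delta_gt0 hx hy hd)/andP[b1 b2]; split=> //; exact: hdist.
apply: (impl_pair (@strip_order_inj a) nxy _ h1 h2 h3 (strip_homo delta a)) => //; rewrite ?hx ?hy //.
  apply: hdist; rewrite ?hy //; move: hd; rewrite /dinf /distn'; lia.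
apply: leq_trans (card_strip_near L delta_gt0 a t x.2).
apply: subset_leq_card; apply/fintype.subsetP=> w; rewrite !inE.
exact: (between_strip delta_gt0).
Qed.

(** The enumeration lists the selected pairs strip by strip, in the order in which [impl_par]
    composes the strips, so no two evolutions have to be exchanged. Between consecutive pairs the
    isometry and its adjoint cancel. *)
Lemma pairs_circuit a (p : pred {set site L}) :
  (forall e, e \in Pset L delta -> p e -> in_strip delta a (strip_index delta a e) e) ->
  exists2 ps : seq {set site L}, perm_eq ps [seq e <- enum (Pset L delta) | p e] &
  exists V : circuit, [/\ circuit_ok V, (gate_count V <= L * (pairs_cost * L))%N,
    (depth V <= pairs_cost * L)%N &
    circ_op V *m JWmat R (order a) = JWmat R (order a) *m evol H theta ps].
Proof.
move=> hp.
pose sp t := [seq e <- enum (Pset L delta) | p e && (strip_index delta a e == t)].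
exists (flatten [seq sp t | t <- iota 0 L]).
  apply: perm_trans (perm_flatten_filter _ _ _ _) _.
  rewrite (@eq_in_filter _ _ p) // => e; rewrite mem_enum => /PsetP[x [y [_ _ ->]]].
  by rewrite (strip_index_lt delta_gt0) andbT.
pose U t := tprod [seq JWmat R (order a) *m ev e *m adj (JWmat R (order a)) | e <- sp t].
have hU t : (t < L)%N -> impl (fun z => strip delta a z.1 == t) (pairs_cost * L) (U t).
  move=> _; have hsp e : e \in sp t -> e \in Pset L delta /\ in_strip delta a t e.
    rewrite mem_filter mem_enum => /andP[/andP[pe /eqP <-] he]; split=> //; exact: hp.
  apply: (@impl_leq _ _ _ (size (sp t) * pair_cost)).
    rewrite /pairs_cost mulnAC leq_mul2r; apply/orP; right.
    by apply: (size_strip_pairs delta_gt0 _ hsp); rewrite filter_uniq // enum_uniq.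
  rewrite -(size_map (fun e => JWmat R (order a) *m ev e *m adj (JWmat R (order a)))).
  by apply: impl_tprod => _ /mapP[e /hsp[h1 h2] ->]; exact: impl_strip_pair.
have [V [v1 v2 v3 v4]] := @impl_par R L L _ (fun z => strip delta a z.1) U hU.
have [u _] := JWmatP R (@strip_order_inj a).
exists V; split=> //; rewrite v4.
have -> : tprod [seq U t | t <- iota 0 L] =
   JWmat R (order a) *m evol H theta (flatten [seq sp t | t <- iota 0 L]) *m adj (JWmat R (order a)).
  rewrite evolE -tprod_conj // -map_comp map_flatten tprod_flatten -!map_comp.
  by congr tprod; apply: eq_map => t; rewrite /U /=.
by case: u => _ u2; rewrite -mulmxA u2 mulmx1.
Qed.

Lemma reorder_circuit a : exists V : circuit,
  [/\ circuit_ok V, (gate_count V <= L * (reorder_cost * L))%N, (depth V <= reorder_cost * L)%N &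
    circ_op V = czop R (@reorder_rel delta L a)].
Proof.
pose U t := czop R (fun x y : site L => reorder_rel delta a x y && (strip delta a x.1 == t)).
have hU t : (t < L)%N -> impl (fun z => strip delta a z.1 == t) (reorder_cost * L) (U t).
  move=> _; have := @impl_reorder R L (strip delta a) t (delta * 2) (delta * 2)
    (fun i => odd (hstrip delta a i)) (strip_homo delta a)
    (fun i j => @strip_dist delta delta_gt0 a t i j) (card_strip L delta_gt0 a t).
  rewrite mulnC; congr (impl _ _ _); apply: eq_czop => x y; rewrite /reorder_rel.
  case: (eqVneq (strip delta a x.1) t) => [<-|]; rewrite ?andbF //= andbT.
  by rewrite [strip delta a y.1 == _]eq_sym; case: (_ == _); rewrite ?andbF.
have [V [v1 v2 v3 v4]] := @impl_par R L L _ (fun z => strip delta a z.1) U hU.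
by exists V; split=> //; rewrite v4 -czop_split // => x; exact: (strip_lt delta_gt0).
Qed.

End Assembly.

Unset Implicit Arguments.

Theorem mainTheorem9 (R : realType) (delta : nat) :
  (1 <= delta)%N ->
  exists K : nat,
  forall (L : nat) (H : {set site L} -> Op R L) (theta : {set site L} -> R),
    (forall x y : site L, x != y -> (dinf x y <= delta)%N ->
       is_hermitian (H [set x; y]) /\ parity_even x y (H [set x; y]) /\
       in_gen_alg [:: cann R x; cann R y; ccre R x; ccre R y] (H [set x; y])) ->
    exists (m0 m1 : ordering L) (ps : seq {set site L}) (V : circuit R L),
      [/\ bijective m0, bijective m1, perm_eq ps (enum (Pset L delta)) & circuit_ok V] /\
      (gate_count V <= K * (L * L))%N /\ (depth V <= K * L)%N /\
      forall Phi0 Phi1 : Op R L, isJW m0 Phi0 -> isJW m1 Phi1 ->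
        circ_op V *m Phi0 = Phi1 *m evol H theta ps.
Proof.
(* The circuit has four parts, two of pair evolutions and two of reordering, and each costs at most
   the sum of the two constants, times [L] in depth and [L * L] in gates. *)
move=> delta_gt0; exists (4 * (pairs_cost delta + reorder_cost delta))%N => L H theta hH.
pose p0 (e : {set site L}) := in_strip delta false (strip_index delta false e) e.
have [ps0 hps0 [V0 [a1 a2 a3 a4]]] := pairs_circuit delta_gt0 theta hH (fun e _ (h : p0 e) => h).
have hp1 e : e \in Pset L delta -> ~~ p0 e -> in_strip delta true (strip_index delta true e) e.
  by move=> /PsetP[x [y [_ hd ->]]]; exact: (strip_cover delta_gt0).
have [ps1 hps1 [V1 [b1 b2 b3 b4]]] := pairs_circuit delta_gt0 theta hH hp1.
have [T0 [c1 c2 c3 c4]] := @reorder_circuit R L delta delta_gt0 false.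
have [T1 [d1 d2 d3 d4]] := @reorder_circuit R L delta delta_gt0 true.
exists (@strip_order delta L false), (@strip_order delta L true), (ps0 ++ ps1), (V0 ++ T0 ++ T1 ++ V1).
split; first split.
- exact/ord_of_key_bij/strip_key_inj.
- exact/ord_of_key_bij/strip_key_inj.
- apply: perm_trans (perm_cat hps0 hps1) _; exact/permPl/perm_filterC.
- by do !apply: circuit_ok_cat.
split; first by rewrite !gate_count_cat; nia.
split; first by rewrite /depth !size_cat; rewrite /depth in a3 b3 c3 d3; nia.
move=> Phi0 Phi1 J0 J1.
have I0 := JWmatP R (@strip_order_inj L delta false).
have I1 := JWmatP R (@strip_order_inj L delta true).
rewrite (isJW_unique J0 I0) (isJW_unique J1 I1) !circ_op_cat.
(* [T0] leads from the unshifted strip order to the half-strip order, [T1] on to the shifted one.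
   Uniqueness then identifies the composite with the explicit isometry that [V1] expects. *)
have JC : isJW (@half_order delta L) (circ_op T0 *m @JWmat R L (@strip_order delta L false)).
  by rewrite c4; apply: isJW_czop I0 => [z|x y]; [exact: reorder_irr | exact: (half_order_lt delta_gt0)].
have J1' : isJW (@strip_order delta L true) (circ_op T1 *m (circ_op T0 *m @JWmat R L (@strip_order delta L false))).
  rewrite d4; apply: isJW_czop JC => [z|x y]; [exact: reorder_irr | exact: (strip_order_lt delta_gt0)].
rewrite -!mulmxA a4 !evolE map_cat tprod_cat -!evolE !mulmxA; congr (_ *m _).
rewrite -!mulmxA (isJW_unique J1' I1) b4.
by [].
Qed.
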